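(* Let $X=\{X_t;\ t\in\mathbf{R}_+\}$ be the stochastic process defined by $$X_t=\int_0^t\eta(u)\,dB_u+\psi(t),$$ where $\eta$ and $\psi$ are $L^2$ deterministic functions and $B$ is standard Brownian motion. Let $t_0\in\mathbf{R}_+$, and let $s'\mapsto\beta_{t_0}(s')$ (resp. $s'\mapsto\gamma_{t_0}(s')$) denote the pseudo-$2$-microlocal frontier at $t_0$ of the function $\varphi:t\mapsto\int_0^t\eta^2(u)\,du$ (resp. of $\psi$). Then the $2$-microlocal frontier of $X$ at $t_0$ in the region $$D=\{(s',\sigma):\ -1<s'<0,\ 0<\sigma<1+s'\}$$ is almost surely equal to $\frac12\beta_{t_0}(2s')\wedge\gamma_{t_0}(s')$, provided the graph of this function $s'\mapsto\frac12\beta_{t_0}(2s')\wedge\gamma_{t_0}(s')$ intersects the region $D$.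
   Context: $\mathbf{R}_+=[0,\infty)$; $B(t_0,\rho)$ is the ball of centre $t_0$ and radius $\rho$ in $\mathbf{R}_+$. The pseudo-$2$-microlocal frontier at $t_0$ of a deterministic function $f$ is the function defined for $s'\in(-\infty,0)$ by $$\Sigma_{t_0}(s')=\sup\Big\{\sigma:\ \limsup_{\rho\to0}\ \sup_{t,u\in B(t_0,\rho),\,t\ne u}\frac{|f(t)-f(u)|}{|t-u|^{\sigma}\rho^{-s'}}<\infty\Big\}.$$ The $2$-microlocal frontier of $X$ at $t_0$ is the random function $$\boldsymbol{\sigma}_{t_0}(s')=\sup\Big\{\sigma:\ \limsup_{\rho\to0}\ \sup_{t,u\in B(t_0,\rho),\,t\ne u}\frac{|X_t-X_u|}{|t-u|^{\sigma}\rho^{-s'}}<\infty\Big\},\quad s'\in(-\infty,0).$$ The first term of $X$ is a Wiener integral (taken in its continuous version). Equality ''in the region $D$'' means that the parts of the two graphs lying in $D$ coincide. $\wedge$ denotes minimum. *)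

(* Defs.v *)
From HB Require Import structures.
From mathcomp Require Import all_boot all_order all_algebra.
From mathcomp Require Import all_classical all_reals all_analysis.

Set Implicit Arguments.
Unset Strict Implicit.
Unset Printing Implicit Defensive.

Import Order.TTheory GRing.Theory Num.Theory.
Import numFieldNormedType.Exports.

Local Open Scope classical_set_scope.
Local Open Scope ring_scope.

(* A function on R_+ is a function on R of which only the values on [0, +oo[
   matter. *)
Definition nonneg_half_line (R : realType) : set R := `[0, +oo[.

Section microlocal_frontier.
Context {R : realType}.
Implicit Types f : R -> R.

Definition ball_half_line (t0 rho : R) : set R :=
  ball t0 rho `&` @nonneg_half_line R.

Definition max_increment_ratio f (t0 s' sigma rho : R) : \bar R :=
  ereal_sup [set (`|f p.1 - f p.2| /
                   (`|p.1 - p.2| `^ sigma * rho `^ (- s')))%:E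
            | p in [set p : R * R | [/\ ball_half_line t0 rho p.1,
                                        ball_half_line t0 rho p.2
                                      & p.1 <> p.2]]].

(* sigma ranges over all the reals, so the value is extended: -oo when no sigma
   is admissible, +oo when arbitrarily large ones are. It is meant for
   s' < 0. *)
Definition frontier f (t0 s' : R) : \bar R :=
  ereal_sup [set sigma%:E | sigma in
    [set sigma : R |
      (limf_esup (max_increment_ratio f t0 s' sigma) 0^'+ < +oo)%E]].

Definition egraph (g : R -> \bar R) : set (R * R) :=
  [set p | g p.1 = p.2%:E].

Definition microlocal_region : set (R * R) :=
  [set p | (-1 < p.1 < 0) && (0 < p.2 < 1 + p.1)].

End microlocal_frontier.

Section wiener_integral.
Context {R : realType} {d : measure_display} {T : measurableType d}.
Variable P : probability T R.

Definition mutually_independent n (Y : 'I_n -> T -> R) : Prop :=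
  forall A : 'I_n -> set R, (forall i, measurable (A i)) ->
    P (\bigcap_i (Y i @^-1` A i)) = (\prod_(i < n) P (Y i @^-1` A i))%E.

(* The times of an increasing finite sequence are the first n.+1 values of
   t : nat -> R. *)
Record brownian_motion (B : R -> {RV P >-> R}) : Prop := BrownianMotion {
  brownian_start : {ae P, forall w, B 0 w = 0} ;
  brownian_increments_normal : forall s t, 0 <= s -> s < t ->
    forall A : set R, measurable A ->
      pushforward P (B t \- B s) A = normal_prob 0 (Num.sqrt (t - s)) A ;
  brownian_increments_independent : forall n (t : nat -> R),
    0 <= t 0 -> {homo t : i j / (i <= j)%N >-> i <= j} ->
    @mutually_independent n (fun i : 'I_n => B (t i.+1) \- B (t i)) ;
  brownian_continuous :
    {ae P, forall w, {within @nonneg_half_line R, continuous (B ^~ w)}}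
}.

(* The triple (c, a, b) stands for the step c * 1_]a, b]. *)
Definition step_on_half_line (s : seq (R * R * R)) : bool :=
  all (fun q => 0 <= q.1.2 <= q.2) s.

Definition step_fun (s : seq (R * R * R)) (x : R) : R :=
  \sum_(q <- s) q.1.1 * \1_`]q.1.2, q.2] x.

Definition step_integral (B : R -> T -> R) (s : seq (R * R * R)) (w : T) : R :=
  \sum_(q <- s) q.1.1 * (B q.2 w - B q.1.2 w).

(* By the Ito isometry the limit is, up to a null event, independent of the
   sequence of step functions approximating f in L^2. *)
Definition wiener_integral_of (B : R -> {RV P >-> R}) (f : R -> R)
    (Y : {RV P >-> R}) : Prop :=
  exists s : nat -> seq (R * R * R),
    [/\ forall n, step_on_half_line (s n),
        Lnorm (@lebesgue_measure R) 2%:E (EFin \o (f \- step_fun (s n)))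
          @[n --> \oo] --> 0%E
      & Lnorm P 2%:E (EFin \o (Y \- step_integral B (s n)))
          @[n --> \oo] --> 0%E].

Definition continuous_wiener_integral (B : R -> {RV P >-> R}) (eta : R -> R)
    (W : R -> {RV P >-> R}) : Prop :=
  (forall t, 0 <= t -> wiener_integral_of B (eta \_ `[0, t]) (W t)) /\
  {ae P, forall w, {within @nonneg_half_line R, continuous (W ^~ w)}}.

End wiener_integral.

(* Main.v *)
(** Write phi(t) for the integral of eta^2 over [0, t]; W_t - W_u is a centred
    Gaussian variable of variance |phi(t) - phi(u)|.

    Lower bound. W is a Brownian motion run at the clock phi, so chaining along
    the times at which phi takes dyadic values gives one almost sure event on
    which W is locally Hoelder of every order a < 1/2 with respect to phi. On it,
    |phi(t) - phi(u)| <= C |t - u|^b rho^(-2s') yields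
    |W_t - W_u| <= C' |t - u|^sigma rho^(-s') as soon as 2 sigma < b.

    Upper bound. If |X_t - X_u| <= L holds with probability at least p, then the
    standard deviation and the mean psi(t) - psi(u) of the Gaussian increment are
    both at most a constant, depending on p only, times L. So if sigma is
    admissible for X at s' with positive outer probability, then 2 sigma is
    admissible for phi at 2s' and sigma for psi at s'. This gives a null set for
    each rational pair (s', sigma), and the general case follows because
    frontiers are nondecreasing and 1-Lipschitz in s'. *)
Require Import Defs.
From HB Require Import structures.
From mathcomp Require Import all_boot all_order all_algebra.
From mathcomp Require Import all_classical all_reals all_analysis.
From mathcomp Require Import measurable_realfun.
From mathcomp Require Import ring lra.
Set Implicit Arguments.
Unset Strict Implicit.
Unset Printing Implicit Defensive.
Import Order.TTheory GRing.Theory Num.Theory.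
Import numFieldNormedType.Exports.
Local Open Scope classical_set_scope.
Local Open Scope ring_scope.

(** Admissibility of a path of X involves uncountably many pairs of times, and the event is not
    shown to be measurable. The upper bound therefore argues with non-negligible sets: such a set
    forces one positive lower bound p on the probabilities of all the elementary events |X_t - X_u|
    <= L that contain it. Since p is common to all rho, t, u, a random statement becomes
    deterministic bounds with uniform constants, and no zero-one law enters.

    The exact law of W_t - W_u is never identified. Step integrals are Gaussian as sums of
    independent increments, and only two inequalities, a tail bound and a small ball bound, are
    passed to the L^2 limit, at the price of larger constants.

    In the lower bound the clock phi may be flat, so a clock value does not determine a time. W is
    sampled at one chosen time per dyadic value; the null set off which these samples converge to
    W_t depends on t. Convergence is therefore used at rational t only, and continuity of the path
    gives the other times. *)

Section increment_bound.
Context {R : realType}.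
Implicit Types (f g : R -> R) (s sigma rho M : R).

(** A single integer serves as the constant and as the inverse of the radius. Admissibility is then
    a countable union over [N], one member of which is non-negligible as soon as the union is. *)
Definition increment_bounded f (t0 : R) s sigma (N : nat) : Prop :=
  forall rho t u, 0 < rho -> rho < N.+1%:R^-1 ->
    ball_half_line t0 rho t -> ball_half_line t0 rho u -> t <> u ->
    `|f t - f u| <= N.+1%:R * (`|t - u| `^ sigma * rho `^ (- s)).

Definition admissible f (t0 : R) s sigma : Prop :=
  exists N, increment_bounded f t0 s sigma N.

Lemma dist_half_line (t0 rho t u : R) : ball_half_line t0 rho t ->
  ball_half_line t0 rho u -> `|t - u| <= 2 * rho.
Proof.
move=> [tr _] [ur _]; move: tr ur; rewrite /ball /=.
rewrite (_ : t - u = (t0 - u) - (t0 - t)); last by ring.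
move=> h1 h2; apply: (le_trans (ler_normB _ _)).
by rewrite mulr_natl mulr2n lerD// ltW.
Qed.

Lemma admissible_ex f (t0 : R) s sigma r M : 0 < r ->
  (forall rho t u, 0 < rho -> rho < r -> ball_half_line t0 rho t ->
    ball_half_line t0 rho u -> t <> u ->
    `|f t - f u| <= M * (`|t - u| `^ sigma * rho `^ (- s))) ->
  admissible f t0 s sigma.
Proof.
move=> r0 H; exists (Num.bound (Num.max r^-1 M)) => rho t u rho0 rhoN bt bu tu.
have hb : Num.max r^-1 M < (Num.bound (Num.max r^-1 M)).+1%:R.
  apply: (le_lt_trans (ler_norm _)).
  apply: (lt_le_trans (archi_boundP (normr_ge0 _))).
  rewrite ler_nat; apply: leqW.
  rewrite -(ler_nat R).
  have h0 : 0 <= Num.max r^-1 M by rewrite le_max invr_ge0 ltW.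
  by rewrite (ger0_norm h0).
move: hb; rewrite gt_max => /andP[h1 h2].
apply: (le_trans (H rho t u rho0 _ bt bu tu)).
  by apply: (lt_trans rhoN); rewrite invf_plt ?posrE.
by apply: ler_wpM2r; [rewrite mulr_ge0 ?powR_ge0|exact: ltW].
Qed.

Lemma admissibleP f (t0 : R) s sigma :
  (limf_esup (max_increment_ratio f t0 s sigma) 0^'+ < +oo)%E <->
  admissible f t0 s sigma.
Proof.
rewrite limf_esupE; split.
- move=> /ereal_inf_lt[_ [V V0 <-]] supoo.
  have [M hM] : exists M : R,
      (ereal_sup [set max_increment_ratio f t0 s sigma x | x in V] <= M%:E)%E.
    move: supoo; case: (ereal_sup _) => [M _|//|_]; first by exists M.
    by exists 0; exact: leNye.
  have [r /= r0 hr] := V0.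
  apply: (@admissible_ex f t0 s sigma r M) => // rho t u rho0 rhor bt bu tu.
  have Vrho : V rho.
    by apply: hr => //=; rewrite sub0r normrN gtr0_norm.
  have h : (max_increment_ratio f t0 s sigma rho <= M%:E)%E.
    by apply: le_trans hM; apply: ereal_sup_ubound; exists rho.
  have : ((`|f t - f u| / (`|t - u| `^ sigma * rho `^ (- s)))%:E <= M%:E)%E.
    by apply: le_trans h; apply: ereal_sup_ubound; exists (t, u).
  rewrite lee_fin ler_pdivrMr// mulr_gt0// powR_gt0//.
  by rewrite normr_gt0 subr_eq0; apply/eqP.
- move=> [N HN].
  apply: (@le_lt_trans _ _ (N.+1%:R)%:E); last exact: ltry.
  apply: (@le_trans _ _ (ereal_sup
      [set max_increment_ratio f t0 s sigma x | x in `]0, N.+1%:R^-1[])).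
    apply: ereal_inf_lbound.
    exists `]0, N.+1%:R^-1[%classic => //.
    exists N.+1%:R^-1 => /=; first by rewrite invr_gt0.
    move=> x /= ; rewrite sub0r normrN => xN x0.
    by rewrite in_itv /= x0/=; apply: le_lt_trans xN; exact: ler_norm.
  apply: ge_ereal_sup => x [rho rhoI <-{x}].
  move: rhoI; rewrite /= in_itv /= => /andP[rho0 rhoN].
  apply: ge_ereal_sup => _ [[t u] /= [bt bu tu] <-].
  rewrite lee_fin ler_pdivrMr; last first.
    by rewrite mulr_gt0// powR_gt0// normr_gt0 subr_eq0; apply/eqP.
  exact: HN.
Qed.

Lemma frontierE f (t0 : R) s :
  frontier f t0 s = ereal_sup [set sigma%:E | sigma in admissible f t0 s].
Proof.
rewrite /frontier; congr (ereal_sup (_ @` _)).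
by apply/funext => sigma; apply/propext; exact: admissibleP.
Qed.

Lemma powR_lower (x sigma sigma' : R) : 0 < x -> x <= 1 -> sigma' <= sigma ->
  x `^ sigma <= x `^ sigma'.
Proof.
move=> x0 x1 ss; rewrite /powR gt_eqF// ler_expR ler_wnM2r//.
by rewrite ln_le0.
Qed.

Lemma admissible_le f (t0 : R) s sigma sigma' : sigma' <= sigma ->
  admissible f t0 s sigma -> admissible f t0 s sigma'.
Proof.
move=> ss [N HN].
(* A radius below 1/2 gives |t - u| <= 2 rho <= 1, where powers decrease in the exponent. *)
apply: (@admissible_ex _ _ _ _ (Num.min 2^-1 N.+1%:R^-1) N.+1%:R).
  by rewrite lt_min !invr_gt0 !ltr0n.
move=> rho t u rho0; rewrite lt_min => /andP[rho2 rhoN] bt bu tu.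
apply: (le_trans (HN rho t u rho0 rhoN bt bu tu)).
rewrite ler_wpM2l// ler_wpM2r ?powR_ge0// powR_lower//.
  by rewrite normr_gt0 subr_eq0; apply/eqP.
apply: (le_trans (dist_half_line bt bu)); lra.
Qed.

Lemma admissible_mono f (t0 : R) s s' sigma : s <= s' ->
  admissible f t0 s sigma -> admissible f t0 s' sigma.
Proof.
move=> ss [N HN]; exists N => rho t u rho0 rhoN bt bu tu.
apply: (le_trans (HN rho t u rho0 rhoN bt bu tu)).
rewrite ler_wpM2l// ler_wpM2l ?powR_ge0// powR_lower//; last by rewrite lerN2.
by apply: (le_trans (ltW rhoN)); rewrite invf_le1// ler1n.
Qed.

(** As |t - u| <= 2 rho, a factor |t - u|^(s' - s) can be exchanged for rho^(s' - s) at the cost of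
    2^(s' - s). This is the Lipschitz property of frontiers, which brings an estimate at a rational
    abscissa back to [s]. *)
Lemma admissible_shift f (t0 : R) s s' sigma : s <= s' ->
  admissible f t0 s' sigma -> admissible f t0 s (sigma - (s' - s)).
Proof.
move=> ss [N HN].
apply: (@admissible_ex _ _ _ _ N.+1%:R^-1 (N.+1%:R * 2 `^ (s' - s))).
  by rewrite invr_gt0.
move=> rho t u rho0 rhoN bt bu tu.
apply: (le_trans (HN rho t u rho0 rhoN bt bu tu)).
have tu0 : 0 < `|t - u| by rewrite normr_gt0 subr_eq0; apply/eqP.
rewrite -mulrA ler_wpM2l//.
have split_exp (x a b : R) : 0 < x -> x `^ (a + b) = x `^ a * x `^ b.
  by move=> x0; rewrite powRD//; apply/implyP => _; rewrite gt_eqF.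
have [d dE] : exists d, d = s' - s by eexists.
rewrite -dE; have -> : - s = - s' + d by rewrite dE; ring.
rewrite -{1}(subrK d sigma) (split_exp _ (sigma - d) d)//
  (split_exp _ (- s') d)//.
have h : `|t - u| `^ d <= 2 `^ d * rho `^ d.
  have rho_ge0 := ltW rho0.
  rewrite -powRM//; apply: ge0_ler_powR; rewrite ?nnegrE ?dE ?subr_ge0//.
    by rewrite mulr_ge0.
  exact: dist_half_line bt bu.
rewrite [leRHS](_ : _ = `|t - u| `^ (sigma - d) * rho `^ (- s') *
  (2 `^ d * rho `^ d)); last by ring.
by rewrite mulrAC ler_wpM2l// mulr_ge0 ?powR_ge0.
Qed.

Lemma admissibleD f g (t0 : R) s sigma : admissible f (t0 : R) s sigma ->
  admissible g t0 s sigma -> admissible (f \+ g) t0 s sigma.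
Proof.
move=> [N HN] [M HM].
apply: (@admissible_ex _ _ _ _ (Num.min N.+1%:R^-1 M.+1%:R^-1)
  (N.+1%:R + M.+1%:R)).
  by rewrite lt_min !invr_gt0 !ltr0n.
move=> rho t u rho0; rewrite lt_min => /andP[rhoN rhoM] bt bu tu /=.
rewrite (_ : f t + g t - (f u + g u) = (f t - f u) + (g t - g u)); last by ring.
apply: (le_trans (ler_normD _ _)); rewrite [leRHS]mulrDl lerD//.
  exact: HN.
exact: HM.
Qed.

Lemma eq_admissible f g (t0 : R) s sigma : (forall t, 0 <= t -> f t = g t) ->
  admissible f t0 s sigma -> admissible g t0 s sigma.
Proof.
move=> fg [N HN]; exists N => rho t u rho0 rhoN bt bu tu.
have [_ ht] := bt; have [_ hu] := bu.
move: ht hu; rewrite /nonneg_half_line /= !in_itv/= !andbT => ht hu.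
by rewrite -!fg//; exact: HN.
Qed.

End increment_bound.

(** * Deterministic comparison of frontiers *)

Section frontier_comparison.
Context {R : realType}.
Implicit Types (f phi psi : R -> R).

Lemma lee_EFinP (a b : \bar R) :
  (forall x : R, (x%:E < a)%E -> (x%:E <= b)%E) -> (a <= b)%E.
Proof.
case: b => [b| |] H; last 2 first.
- exact: leey.
- case: a H => [a| |] H //.
  + by have := H (a - 1); rewrite lte_fin leeNy_eq => /(_ ltac:(lra)).
  + by have := H 0; rewrite leeNy_eq => /(_ (ltry _)).
case: a H => [a| |] H; last exact: leNye.
- rewrite lee_fin leNgt; apply/negP => ba.
  have := H ((a + b) / 2); rewrite lte_fin lee_fin => /(_ ltac:(lra)).
  lra.
- by have := H (b + 1) (ltry _); rewrite lee_fin => h; exfalso; lra.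
Qed.

(* [a] tends to 1/2, so that the exponents [b * a - sigma] and
   [- 2 * s * a + s] tend to [b / 2 - sigma > 0] and [0]. *)
Lemma admissible_half_modulus phi f (t0 s sigma b : R) : s < 0 ->
  2 * sigma < b ->
  (forall a, 0 < a -> a < 2^-1 -> exists C r, [/\ 0 <= C, 0 < r &
    forall t u, ball_half_line t0 r t -> ball_half_line t0 r u ->
      `|f t - f u| <= C * `|phi t - phi u| `^ a]) ->
  admissible phi t0 (2 * s) b -> admissible f t0 s sigma.
Proof.
move=> s0 sb Hf [N HN].
pose e := b / 2 - sigma; pose K := `|b| + 2 * `|s| + 1.
have e0 : 0 < e by rewrite /e; lra.
have K0 : 0 < K by have := normr_ge0 b; have := normr_ge0 s; rewrite /K; lra.
(* The bound 1/4 keeps [a] positive. The bound e / (2 K) makes |b eps| and |2 s eps| at most e / 2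
   each, so that the exponents [h] and [k] below are nonnegative. *)
pose eps := Num.min 4^-1 (e / (2 * K)).
have eps0 : 0 < eps.
  by rewrite lt_min; apply/andP; split; [lra | rewrite divr_gt0// mulr_gt0].
have eps4 : eps <= 4^-1 by rewrite ge_min lexx.
have epsK : eps * K <= e / 2.
  have : eps <= e / (2 * K) by rewrite ge_min lexx orbT.
  by rewrite ler_pdivlMr ?mulr_gt0//; lra.
have bE : `|b * eps| <= e / 2 /\ `|2 * s * eps| <= e / 2.
  rewrite !normrM (gtr0_norm eps0) (@ger0_norm _ 2)//.
  have h1 : `|b| * eps <= K * eps.
    by rewrite ler_pM2r// /K; have := normr_ge0 s; lra.
  have h2 : 2 * `|s| * eps <= K * eps.
    by rewrite ler_pM2r// /K; have := normr_ge0 b; lra.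
  by split; lra.
have [/ler_normlP[h1 h1'] /ler_normlP[h2 h2']] := bE.
pose a := 2^-1 - eps.
have a0 : 0 < a by rewrite /a; lra.
have a2 : a < 2^-1 by rewrite /a; lra.
have [C [r [C0 r0 HC]]] := Hf a a0 a2.
(* [h] is the power of |t - u| in excess of [sigma]; it is traded for (2 rho)^h. [k] is the power of
   rho then left in excess of [- s], harmless because rho <= 1. *)
pose h := b * a - sigma.
have hE : h = e - b * eps by rewrite /h /e /a; field.
have h0 : 0 <= h by rewrite hE; lra.
pose k := h + (- (2 * s)) * a + s.
have kE : k = e - b * eps + 2 * s * eps by rewrite /k hE /a; field.
have k0 : 0 <= k by rewrite kE; lra.
apply: (@admissible_ex _ _ _ _ _ (Num.min r N.+1%:R^-1)
  (C * N.+1%:R `^ a * 2 `^ h)).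
  by rewrite lt_min r0 invr_gt0 ltr0n.
move=> rho t u rho0; rewrite lt_min => /andP[rhor rhoN] bt bu tu.
have rho1 : rho <= 1.
  by apply: (le_trans (ltW rhoN)); rewrite invf_le1// ler1n.
have sub x : ball_half_line t0 rho x -> ball_half_line t0 r x.
  by move=> [bx ?]; split => //; apply: le_ball bx; exact: ltW.
apply: (le_trans (HC t u (sub _ bt) (sub _ bu))).
have tu0 : 0 < `|t - u| by rewrite normr_gt0 subr_eq0; apply/eqP.
have split_exp (x p q : R) : 0 < x -> x `^ (p + q) = x `^ p * x `^ q.
  by move=> x0; rewrite powRD//; apply/implyP => _; rewrite gt_eqF.
rewrite -!mulrA ler_wpM2l//.
have step1 : `|phi t - phi u| `^ a <=
    N.+1%:R `^ a * (`|t - u| `^ (b * a) * rho `^ (- (2 * s) * a)).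
  rewrite !powRrM -!powRM ?powR_ge0// ?mulr_ge0 ?powR_ge0//.
  apply: ge0_ler_powR; rewrite ?nnegrE ?(ltW a0) ?mulr_ge0 ?powR_ge0//.
  exact: HN.
apply: (le_trans step1); rewrite ler_wpM2l ?powR_ge0//.
have -> : b * a = sigma + h by rewrite /h; ring.
rewrite split_exp//.
have step2 : `|t - u| `^ h <= 2 `^ h * rho `^ h.
  have rho_ge0 := ltW rho0.
  rewrite -powRM//; apply: ge0_ler_powR; rewrite ?nnegrE//.
    by rewrite mulr_ge0.
  exact: dist_half_line bt bu.
have step3 : rho `^ h * rho `^ (- (2 * s) * a) <= rho `^ (- s).
  rewrite -split_exp//; apply: powR_lower => //.
  by move: k0; rewrite /k; lra.
rewrite -!mulrA [leRHS]mulrCA ler_wpM2l ?powR_ge0//.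
apply: (le_trans (ler_wpM2r (powR_ge0 _ _) step2)).
by rewrite -mulrA ler_wpM2l ?powR_ge0.
Qed.

Lemma frontier_min phi psi f g (t0 s : R) : s < 0 ->
  (forall t, 0 <= t -> f t = g t + psi t) ->
  (forall sigma b, 2 * sigma < b -> admissible phi t0 (2 * s) b ->
    admissible g t0 s sigma) ->
  (forall q sigma : rat, ratr q < 0 :> R ->
    admissible f t0 (ratr q) (ratr sigma) ->
    admissible phi t0 (2 * ratr q) (2 * ratr sigma) /\
    admissible psi t0 (ratr q) (ratr sigma)) ->
  frontier f t0 s =
  mine ((2^-1)%:E * frontier phi t0 (2 * s))%E (frontier psi t0 s).
Proof.
move=> s0 fE lower upper; rewrite !frontierE; apply/eqP; rewrite eq_le.
apply/andP; split.
- apply: ge_ereal_sup => _ [sigma adm <-]; apply: lee_EFinP => x.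
  rewrite lte_fin => xsigma.
  (* The rational point is taken in ]s, s + h[ x ]sigma - h, sigma[. The bound [- s] keeps its
     abscissa negative. Approximating [sigma] and shifting back to [s] lose at most h each, and 2 h
     <= sigma - x; for [phi] all quantities are doubled. *)
  pose h := Num.min ((sigma - x) / 2) (- s).
  have hx : h <= (sigma - x) / 2 by rewrite ge_min lexx.
  have hs : h <= - s by rewrite ge_min lexx orbT.
  have h0 : 0 < h by rewrite lt_min; apply/andP; split; lra.
  have [q /[!in_itv]/= /andP[q1 q2]] := @rat_in_itvoo R s (s + h) ltac:(lra).
  have [p /[!in_itv]/= /andP[p1 p2]] := @rat_in_itvoo R (sigma - h) sigma ltac:(lra).
  have q0 : ratr q < 0 :> R by apply: (lt_le_trans q2); lra.
  have [] := upper q p q0.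
    by apply: (admissible_mono (ltW q1)); apply: admissible_le adm; lra.
  have q12 : 2 * s <= 2 * ratr q :> R by rewrite ler_pM2l// ltW.
  move=> /(admissible_shift q12) adm1.
  move=> /(admissible_shift (ltW q1)) adm2.
  rewrite le_min lee_pdivlMl//; apply/andP; split.
    apply: ereal_sup_ubound; exists (2 * x) => //.
    by apply: admissible_le adm1; lra.
  apply: ereal_sup_ubound; exists x => //.
  by apply: admissible_le adm2; lra.
- apply: lee_EFinP => x; rewrite lt_min lte_pdivlMl// => /andP[xb xc].
  have [_ [b admb <-]] := ereal_sup_gt xb.
  have [_ [c admc <-]] := ereal_sup_gt xc.
  rewrite !lte_fin => xc' xb'.
  apply: ereal_sup_ubound; exists x => //.
  apply: (@eq_admissible _ (g \+ psi)) => [t t0'|]; first by rewrite fE.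
  apply: admissibleD; first exact: lower xb' admb.
  by apply: admissible_le admc; exact: ltW.
Qed.

End frontier_comparison.

(** * Scaling of Lebesgue measure and of normal laws *)

Section normal_scaling.
Context {R : realType}.
Local Notation mu := (@lebesgue_measure R).

Lemma lebesgue_measure_scale (c : R) (A : set R) : c != 0 -> measurable A ->
  mu A = (`|c|%:E * mu (( *%R c) @^-1` A))%E.
Proof.
move=> c0 mA.
have mc : measurable_fun [set: measurableTypeR R]
    ( *%R c : measurableTypeR R -> measurableTypeR R).
  exact: mulrl_measurable.
apply: (@lebesgue_measure_unique _
  (mscale (NngNum (normr_ge0 c)) (pushforward mu
     ( *%R c : measurableTypeR R -> measurableTypeR R)))) => //.
move=> _ [[a b] _ <-] /=.
(* For negative [c] the preimage of ]a, b] is closed on the left and open on the right, so the two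
   signs are treated apart. *)
have [cneg|cpos] := ltP c 0.
  rewrite /mscale /= /pushforward.
  have -> : ( *%R c) @^-1` `]a, b] = `[b / c, a / c[%classic.
    apply/seteqP; split => x /=; rewrite !in_itv/=.
      by rewrite ler_ndivrMr// ltr_ndivlMr// !(mulrC x) => /andP[-> ->].
    by rewrite ler_ndivrMr// ltr_ndivlMr// !(mulrC x) => /andP[-> ->].
  rewrite !lebesgue_measure_itv/= !lte_fin ltr_nM2r ?invr_lt0//.
  case: ifPn => // ab; last by rewrite mule0.
  rewrite -!EFinB -EFinM ltr0_norm// -mulrBl mulrCA.
  by rewrite mulNr divff ?lt_eqF// mulrN1 opprB.
have {}cpos : 0 < c by rewrite lt_neqAle eq_sym c0.
rewrite /mscale /= /pushforward.
have -> : ( *%R c) @^-1` `]a, b] = `]a / c, b / c]%classic.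
  apply/seteqP; split => x /=; rewrite !in_itv/=.
    by rewrite ler_pdivlMr// ltr_pdivrMr// !(mulrC x).
  by rewrite ler_pdivlMr// ltr_pdivrMr// !(mulrC x).
rewrite !lebesgue_measure_itv/= !lte_fin ltr_pM2r ?invr_gt0//.
case: ifPn => // ab; last by rewrite mule0.
by rewrite -!EFinB -EFinM gtr0_norm// -mulrBl mulrC divfK.
Qed.

(** Change of variables: the Jacobian |c| cancels the factor 1 / |c| between the two normal
    peaks. *)
Lemma normal_prob_scale (c s : R) (A : set R) : c != 0 -> s != 0 ->
  measurable A ->
  normal_prob 0 (c * s) A = normal_prob 0 s (( *%R c) @^-1` A).
Proof.
move=> c0 s0 mA.
have mc : measurable_fun [set: measurableTypeR R]
    ( *%R c : measurableTypeR R -> measurableTypeR R).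
  exact: mulrl_measurable.
have mpdf (t : R) (D : set R) : measurable_fun D (fun x => (normal_pdf 0 t x)%:E).
  by apply/measurable_EFinP; apply: measurable_funTS; exact: measurable_normal_pdf.
rewrite /normal_prob.
etransitivity.
  apply: (@eq_measure_integral _ _ _ _
    (mscale (NngNum (normr_ge0 c)) (pushforward mu
     ( *%R c : measurableTypeR R -> measurableTypeR R)))) => // D mD _.
  exact: lebesgue_measure_scale.
have pdf_ge0 t x : (0 <= (normal_pdf 0 t x : R)%:E)%E.
  by rewrite lee_fin normal_pdf_ge0.
rewrite ge0_integral_mscale//=; last exact: mpdf.
rewrite ge0_integral_pushforward//=; last exact: mpdf.
rewrite -ge0_integralZl//=.
- apply: eq_integral => x _.
  rewrite -EFinM !normal_pdfE// ?mulf_neq0//; congr EFin.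
  rewrite mulrA; congr (_ * _).
    rewrite /normal_peak.
    have -> : (c * s) ^+ 2 * pi *+ 2 = c ^+ 2 * (s ^+ 2 * pi *+ 2) :> R.
      by rewrite exprMn mulrnAr mulrA.
    rewrite (sqrtrM _ (sqr_ge0 c)) sqrtr_sqr.
    by rewrite invfM mulrA divff ?normr_eq0// mul1r.
  rewrite /normal_fun !subr0 !exprMn; congr expR.
  rewrite -!mulrnAr !invfM; field.
  by rewrite c0 s0.
- rewrite -(setTI (_ @^-1` _)); exact: mc.
- apply: measurableT_comp => //; apply: measurable_funTS.
  apply: measurableT_comp => //; exact: measurable_normal_pdf.
Qed.

End normal_scaling.

(** * Sums of independent Gaussian variables *)

Section joint_law.
Context {R : realType} {d : measure_display} {T : measurableType d}.
Variable P : probability T R.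

(** Conditionally on [E], the pair (X, Y) and the independent pair (X', Y') agree on rectangles,
    hence everywhere. One use keeps the pair and lets [E] carry the variables not yet summed; the
    other takes [E] full and replaces the pair by Brownian increments. *)
Lemma joint_law_unique (X Y X' Y' : {RV P >-> R}) (E : set T) :
  measurable E ->
  (forall A D : set R, measurable A -> measurable D ->
    P (X @^-1` A `&` Y @^-1` D `&` E) =
    P (X' @^-1` A) * P (Y' @^-1` D) * P E)%E ->
  (forall A D : set R, measurable A -> measurable D ->
    P (X' @^-1` A `&` Y' @^-1` D) = P (X' @^-1` A) * P (Y' @^-1` D))%E ->
  forall C : set (R * R), measurable C ->
    (P ((fun w => (X w, Y w)) @^-1` C `&` E) =
     P ((fun w => (X' w, Y' w)) @^-1` C) * P E)%E.
Proof.
move=> mE XY X'Y' C mC.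
have mXY : measurable_fun setT (fun w => (X w, Y w)) by exact: measurable_fun_pair.
have mXY' : measurable_fun setT (fun w => (X' w, Y' w)) by exact: measurable_fun_pair.
pose m1 := distribution P X'; pose m2 := distribution P Y'.
have h' : (m1 \x m2)%E C = P ((fun w => (X' w, Y' w)) @^-1` C).
  by apply: (@product_measure_unique _ _ _ _ _ m1 m2
    (pushforward P (fun w => (X' w, Y' w)))) => //; exact: X'Y'.
rewrite -h'.
have [PE0|PE0] := eqVneq (P E) 0%E.
  rewrite PE0 mule0; apply/eqP; rewrite eq_le measure_ge0 andbT -PE0.
  apply: le_measure; rewrite ?inE//; apply: measurableI => //.
  by rewrite -(setTI (_ @^-1` _)); exact: mXY.
have PEfin : P E \is a fin_num by exact: fin_num_measure.
pose p := fine (P E).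
have PEp : P E = p%:E by rewrite fineK.
have p0 : 0 < p by rewrite -lte_fin -PEp lt0e PE0 measure_ge0.
have pV0 : 0 <= p^-1 by rewrite invr_ge0 ltW.
have -> : (m1 \x m2)%E C = (p^-1%:E * P ((fun w => (X w, Y w)) @^-1` C `&` E))%E.
  apply: (@product_measure_unique _ _ _ _ _ m1 m2
    (mscale (NngNum pV0) (pushforward (mrestr P mE) (fun w => (X w, Y w))))) => //.
  move=> A D mA mD.
  transitivity (p^-1%:E * P (X @^-1` A `&` Y @^-1` D `&` E))%E => //.
  rewrite XY//.
  by rewrite PEp muleC -muleA -EFinM divff ?gt_eqF// mule1.
by rewrite PEp muleC muleA -EFinM divff ?gt_eqF// mul1e.
Qed.

End joint_law.

Section gaussian_sum.
Context {R : realType} {d : measure_display} {T : measurableType d}.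
Variable P : probability T R.

(* A null standard deviation is set apart because [normal_prob 0 0] is not a
   Dirac measure. *)
Definition centered_gaussian (Y : T -> R) (s : R) : Prop :=
  (s = 0 /\ forall w, Y w = 0) \/
  (0 < s /\ forall A : set R, measurable A -> P (Y @^-1` A) = normal_prob 0 s A).

Lemma centered_gaussianZ (Y : {RV P >-> R}) (c s : R) :
  centered_gaussian Y s -> centered_gaussian (c \o* Y) (`|c| * s).
Proof.
case=> [[-> Y0]|[s0 lawY]].
  by left; rewrite mulr0; split=> // w /=; rewrite Y0 mul0r.
have [->|c0] := eqVneq c 0.
  by left; rewrite normr0 mul0r; split => // w /=; rewrite mulr0.
right; split=> [|A mA]; first by rewrite mulr_gt0// normr_gt0.
have mcA : measurable ( *%R c @^-1` A).
  by rewrite -(setTI (_ @^-1` _)); exact: mulrl_measurable.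
have -> : (c \o* Y) @^-1` A = Y @^-1` ( *%R c @^-1` A).
  by apply/seteqP; split => w /=; rewrite mulrC.
have sN0 : s != 0 by rewrite gt_eqF.
rewrite lawY// -normal_prob_scale//.
rewrite /normal_prob; apply: eq_integral => x _; congr EFin.
rewrite !normal_pdfE ?mulf_neq0 ?normr_eq0//.
by rewrite /normal_peak /normal_fun !exprMn real_normK ?num_real.
Qed.

Definition partial_sum (Y : nat -> T -> R) (k : nat) (w : T) : R :=
  \sum_(i < k) Y i w.

(** Induction moves [Y k] from the product into the sum. The event that the new sum lies in [A] is
    not a rectangle in the old sum and [Y k], so their joint law on the event carried by the later
    variables is needed. *)
Lemma independent_sum n (Y : nat -> {RV P >-> R}) :
  (forall D : nat -> set R, (forall i, measurable (D i)) ->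
    P (\bigcap_(i in `I_n) (Y i @^-1` D i)) =
    (\prod_(i < n) P (Y i @^-1` D i))%E) ->
  forall k, (k <= n)%N ->
  forall A (D : nat -> set R), measurable A -> (forall i, measurable (D i)) ->
    P (partial_sum Y k @^-1` A `&`
       \bigcap_(i in [set i | (k <= i < n)%N]) (Y i @^-1` D i)) =
    (P (partial_sum Y k @^-1` A) *
     \prod_(k <= i < n) P (Y i @^-1` D i))%E.
Proof.
move=> indep; elim=> [_|k IH kn] A D mA mD.
  rewrite big_mkord -indep//.
  have -> : \bigcap_(i in [set i | (0 <= i < n)%N]) (Y i @^-1` D i) =
      \bigcap_(i in `I_n) (Y i @^-1` D i) by [].
  (* The empty sum is the constant 0, whose preimage of [A] is everything or nothing. *)
  have [A0|A0] := pselect (A 0).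
    have -> : partial_sum Y 0 @^-1` A = setT.
      by apply/seteqP; split => w //= _; rewrite /partial_sum big_ord0.
    by rewrite setTI probability_setT mul1e.
  have -> : partial_sum Y 0 @^-1` A = set0.
    by apply/seteqP; split => w //=; rewrite /partial_sum big_ord0.
  by rewrite set0I measure0 mul0e.
have mY i B : measurable B -> measurable (Y i @^-1` B).
  by move=> mB; exact: measurable_funPTI.
have mS : measurable_fun setT (partial_sum Y k).
  by apply: measurable_sum => i; exact: measurable_funP.
pose S : {RV P >-> R} := HB.pack (partial_sum Y k)
  (isMeasurableFun.Build _ _ _ _ _ mS).
pose E := \bigcap_(i in [set i | (k.+1 <= i < n)%N]) (Y i @^-1` D i).
have mE : measurable E by apply: bigcap_measurableType => i _; exact: mY.
have base B F : measurable B -> measurable F ->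
    P (S @^-1` B `&` Y k @^-1` F `&` E) =
    (P (S @^-1` B) * P (Y k @^-1` F) * \prod_(k.+1 <= i < n) P (Y i @^-1` D i))%E.
  move=> mB mF.
  have := IH (ltnW kn) B (fun i => if i == k then F else D i) mB.
  rewrite (big_ltn kn) eqxx.
  rewrite (_ : \bigcap_(i in [set i | (k <= i < n)%N])
    Y i @^-1` (if i == k then F else D i) = Y k @^-1` F `&` E); last first.
    apply/seteqP; split => w.
      move=> H; split.
        by have := H k; rewrite /= eqxx; apply; rewrite leqnn.
      move=> i /andP[ki ik]; have := H i; rewrite /= gtn_eqF//; apply.
      by rewrite ik ltnW.
    move=> [H1 H2] i /=; rewrite leq_eqVlt => /andP[/orP[/eqP <- _|ki ik]].
      by rewrite eqxx.
    by rewrite gtn_eqF//; apply: H2; rewrite /= ki.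
  rewrite setIA => ->; last by move=> i; case: ifP.
  rewrite muleA; congr (_ * _)%E.
  by apply: eq_big_nat => i /andP[ki _]; rewrite gtn_eqF.
have PE : P E = (\prod_(k.+1 <= i < n) P (Y i @^-1` D i))%E.
  have := base setT setT measurableT measurableT.
  by rewrite !preimage_setT !setTI probability_setT !mul1e.
have SYindep B F : measurable B -> measurable F ->
    P (S @^-1` B `&` Y k @^-1` F) = (P (S @^-1` B) * P (Y k @^-1` F))%E.
  move=> mB mF.
  have := IH (ltnW kn) B (fun i => if i == k then F else setT) mB.
  rewrite (big_ltn kn) eqxx.
  rewrite (_ : \bigcap_(i in [set i | (k <= i < n)%N])
    Y i @^-1` (if i == k then F else setT) = Y k @^-1` F); last first.
    apply/seteqP; split => w.
      by move=> H; have := H k; rewrite /= eqxx; apply; rewrite leqnn.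
    by move=> H i /= _; case: eqP => // ->.
  rewrite big1_seq ?mule1; first by apply => i; case: ifP.
  move=> i /andP[_]; rewrite mem_index_iota => /andP[ki _].
  by rewrite gtn_eqF// preimage_setT probability_setT.
have mC : measurable [set z : R * R | A (z.1 + z.2)].
  rewrite -(setTI [set _ | _]).
  exact: (measurable_funD (@measurable_fst _ _ R R) (@measurable_snd _ _ R R)).
have SSE : partial_sum Y k.+1 @^-1` A =
    (fun w => (S w, Y k w)) @^-1` [set z : R * R | A (z.1 + z.2)].
  by apply/seteqP; split => w /=; rewrite /partial_sum big_ord_recr.
rewrite SSE -PE -/(S : T -> R).
apply: joint_law_unique => // B F mB mF.
by rewrite PE base.
Qed.

End gaussian_sum.

Section brownian_step_integral.
Context {R : realType} {d : measure_display} {T : measurableType d}.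
Variable P : probability T R.
Variable B : R -> {RV P >-> R}.
Hypothesis hB : brownian_motion B.

Lemma brownian_increment_gaussian s t : 0 <= s -> s <= t ->
  centered_gaussian P (B t \- B s) (Num.sqrt (t - s)).
Proof.
move=> s0; rewrite le_eqVlt => /predU1P[->|st].
  by left; rewrite subrr sqrtr0; split => // w /=; rewrite subrr.
right; rewrite sqrtr_gt0 subr_gt0; split => // A mA.
exact: (brownian_increments_normal hB).
Qed.

(* The convolution identity for normal laws is read off two consecutive
   increments of the Brownian motion. *)
Lemma centered_gaussianD (X Y : {RV P >-> R}) (a b : R) :
  (forall A D : set R, measurable A -> measurable D ->
    P (X @^-1` A `&` Y @^-1` D) = P (X @^-1` A) * P (Y @^-1` D))%E ->
  centered_gaussian P X a -> centered_gaussian P Y b ->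
  centered_gaussian P (X \+ Y) (Num.sqrt (a ^+ 2 + b ^+ 2)).
Proof.
move=> XY [[-> X0]|[a0 lawX]] gY.
  rewrite expr0n/= add0r sqrtr_sqr ger0_norm; last first.
    by case: gY => [[-> _]//|[/ltW]].
  rewrite (_ : X \+ Y = Y :> (T -> R))//.
  by apply/funext => w /=; rewrite X0 add0r.
case: gY => [[-> Y0]|[b0 lawY]].
  rewrite expr0n/= addr0 sqrtr_sqr gtr0_norm//.
  rewrite (_ : X \+ Y = X :> (T -> R)); first by right.
  by apply/funext => w /=; rewrite Y0 addr0.
have a20 : 0 < a ^+ 2 by rewrite exprn_gt0.
have b20 : 0 < b ^+ 2 by rewrite exprn_gt0.
have ab20 : 0 < a ^+ 2 + b ^+ 2 by rewrite addr_gt0.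
right; rewrite sqrtr_gt0; split => // A mA.
(* The times 0, a^2, a^2 + b^2, constant afterwards: the two increments have standard deviations [a]
   and [b]. *)
pose t (i : nat) : R := if i is i'.+1 then
  if i' is 0%N then a ^+ 2 else a ^+ 2 + b ^+ 2 else 0.
have tle : {homo t : i j / (i <= j)%N >-> i <= j}.
  move=> [|[|i]] [|[|j]] //= _; first exact: ltW.
    exact: ltW.
  by rewrite lerDl ltW.
pose X' : {RV P >-> R} := (B (a ^+ 2) \- B 0)%R.
pose Y' : {RV P >-> R} := (B (a ^+ 2 + b ^+ 2) \- B (a ^+ 2))%R.
have lawX' D : measurable D -> P (X' @^-1` D) = normal_prob 0 a D.
  move=> mD; rewrite -[a in RHS](ger0_norm (ltW a0)) -sqrtr_sqr.
  rewrite -[a ^+ 2 in RHS]subr0.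
  exact: (brownian_increments_normal hB).
have lawY' D : measurable D -> P (Y' @^-1` D) = normal_prob 0 b D.
  move=> mD; rewrite -[b in RHS](ger0_norm (ltW b0)) -sqrtr_sqr.
  have <- : a ^+ 2 + b ^+ 2 - a ^+ 2 = b ^+ 2 by rewrite addrC addKr.
  by apply: (brownian_increments_normal hB); rewrite ?ltW// ltrDl.
have XY' C D : measurable C -> measurable D ->
    (P (X' @^-1` C `&` Y' @^-1` D) = P (X' @^-1` C) * P (Y' @^-1` D))%E.
  move=> mC mD.
  have := @brownian_increments_independent _ _ _ _ _ hB 2%N t (lexx _) tle
    (fun i : 'I_2 => if i == ord0 then C else D).
  rewrite big_ord_recl big_ord1 /=.
  have -> : \bigcap_i ((fun i : 'I_2 => B (t i.+1) \- B (t i)) i @^-1`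
      (if i == ord0 then C else D)) = X' @^-1` C `&` Y' @^-1` D.
    apply/seteqP; split => w.
      move=> H; split; first by have := H ord0 I.
      by have := H (lift ord0 ord0) I.
    move=> [HC HD] i _ /=; case: (unliftP ord0 i) => [j|] -> //=.
    by rewrite (ord1 j).
  by apply => i; case: ifP.
have mA2 : measurable [set z : R * R | A (z.1 + z.2)].
  rewrite -(setTI [set _ | _]).
  exact: (measurable_funD (@measurable_fst _ _ R R) (@measurable_snd _ _ R R)).
have := @joint_law_unique _ _ _ P X Y X' Y' setT measurableT _ XY' _ mA2.
rewrite setIT probability_setT mule1 => ->.
  have -> : (fun w => (X' w, Y' w)) @^-1` [set z : R * R | A (z.1 + z.2)] =
      (B (a ^+ 2 + b ^+ 2) \- B 0) @^-1` A.
    have E w : X' w + Y' w = B (a ^+ 2 + b ^+ 2) w - B 0 w by rewrite /=; ring.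
    by apply/seteqP; split => w; rewrite /preimage/= E.
  rewrite -[a ^+ 2 + b ^+ 2 in RHS]subr0.
  exact: (brownian_increments_normal hB).
move=> C D mC mD.
by rewrite setIT mule1 XY// lawX// lawY// lawX'// lawY'.
Qed.

Lemma gaussian_sum n (Y : nat -> {RV P >-> R}) (b : nat -> R) :
  (forall D : nat -> set R, (forall i, measurable (D i)) ->
    P (\bigcap_(i in `I_n) (Y i @^-1` D i)) =
    (\prod_(i < n) P (Y i @^-1` D i))%E) ->
  (forall i, (i < n)%N -> centered_gaussian P (Y i) (b i)) ->
  centered_gaussian P (partial_sum Y n) (Num.sqrt (\sum_(i < n) b i ^+ 2)).
Proof.
move=> indep gY.
suff : forall k, (k <= n)%N ->
    centered_gaussian P (partial_sum Y k) (Num.sqrt (\sum_(i < k) b i ^+ 2)).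
  by apply.
elim=> [_|k IH kn].
  by left; rewrite big_ord0 sqrtr0; split => // w; rewrite /partial_sum big_ord0.
have mS : measurable_fun setT (partial_sum Y k).
  by apply: measurable_sum => i; exact: measurable_funP.
pose S : {RV P >-> R} := HB.pack (partial_sum Y k)
  (isMeasurableFun.Build _ _ _ _ _ mS).
have -> : partial_sum Y k.+1 = S \+ Y k.
  by apply/funext => w; rewrite /partial_sum big_ord_recr.
rewrite big_ord_recr/=.
rewrite -[X in Num.sqrt (X + _)]sqr_sqrtr; last first.
  by apply: sumr_ge0 => i _; exact: sqr_ge0.
apply: (@centered_gaussianD S (Y k)); [|exact: IH (ltnW kn)|exact: gY].
move=> A D mA mD.
have := independent_sum indep (ltnW kn) mA
  (D := fun i => if i == k then D else setT).
rewrite (big_ltn kn) eqxx.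
rewrite (_ : \bigcap_(i in [set i | (k <= i < n)%N])
  Y i @^-1` (if i == k then D else setT) = Y k @^-1` D); last first.
  apply/seteqP; split => w.
    by move=> H; have := H k; rewrite /= eqxx; apply; rewrite leqnn.
  by move=> H i /= _; case: eqP => // ->.
rewrite big1_seq ?mule1; first by apply => i; case: ifP.
move=> i /andP[_]; rewrite mem_index_iota => /andP[ki _].
by rewrite gtn_eqF// preimage_setT probability_setT.
Qed.

End brownian_step_integral.

(** * Step functions on a grid and their Brownian integrals *)

Section step_integral.
Context {R : realType} {d : measure_display} {T : measurableType d}.
Variable P : probability T R.
Variable B : R -> {RV P >-> R}.
Hypothesis hB : brownian_motion B.
Local Notation mu := (@lebesgue_measure R).

(** The steps of [s] may overlap, and their Brownian increments are then dependent. Cutting at all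
    end points gives consecutive cells with independent increments. *)
Definition grid_points (s : seq (R * R * R)) : seq R :=
  sort <=%R ([seq q.1.2 | q <- s] ++ [seq q.2 | q <- s]).

(* The grid is constant past its last point. *)
Definition grid s (i : nat) : R :=
  nth 0 (grid_points s) (minn i (size (grid_points s)).-1).

Lemma grid_homo s : {homo grid s : i j / (i <= j)%N >-> i <= j}.
Proof.
move=> i j ij; rewrite /grid; set p := grid_points s.
have [->|p0] := eqVneq p [::]; first by rewrite !nth_nil.
have p1 : (0 < size p)%N by rewrite lt0n size_eq0.
have minlt k : (minn k (size p).-1 < size p)%N by rewrite gtn_min prednK// leqnn orbT.
apply: (@sorted_leq_nth _ <=%R le_trans le_refl) => //.
- exact: sort_sorted le_total _.
- exact: minlt.
- exact: minlt.
- by rewrite leq_min geq_minr andbT (leq_trans (geq_minl _ _)).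
Qed.

Lemma mem_grid s x : x \in grid_points s ->
  exists2 j, (j <= size (grid_points s))%N & x = grid s j.
Proof.
move=> xs; exists (index x (grid_points s)); first exact: index_size.
rewrite /grid (minn_idPl _) ?nth_index//.
by move: xs; rewrite -index_mem; case: (size _) => // n; rewrite ltnS.
Qed.

Lemma grid0_ge0 s : step_on_half_line s -> 0 <= grid s 0.
Proof.
move=> /allP hs; rewrite /grid min0n.
have [->//|p0] := eqVneq (grid_points s) [::].
have : nth 0 (grid_points s) 0 \in grid_points s.
  by apply: mem_nth; rewrite lt0n size_eq0.
rewrite mem_sort mem_cat => /orP[] /mapP[q qs ->]; have /andP[] := hs _ qs => //.
by move=> q0; exact: le_trans.
Qed.

(** Points may be repeated in the grid, so the comparison of values can hold for some i >= j as
    well; such cells are degenerate and contribute zero. *)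
Lemma grid_telescope s n (g : R -> R) j : (j <= n)%N ->
  g (grid s j) - g (grid s 0) =
  \sum_(i < n) (grid s i.+1 <= grid s j)%R%:R * (g (grid s i.+1) - g (grid s i)).
Proof.
move=> jn.
rewrite -(big_mkord xpredT (fun i =>
  (grid s i.+1 <= grid s j)%R%:R * (g (grid s i.+1) - g (grid s i)))).
rewrite (@big_cat_nat _ _ _ j)//=.
rewrite [X in _ = _ + X]big1_seq ?addr0; last first.
  move=> i /andP[_]; rewrite mem_index_iota => /andP[ji _].
  have [h|h] := leP (grid s i.+1) (grid s j); last by rewrite mul0r.
  have h1 : grid s i.+1 = grid s j.
    by apply/eqP; rewrite eq_le h grid_homo// ltnW.
  have h2 : grid s i = grid s j.
    by apply/eqP; rewrite eq_le -{1}h1 !grid_homo.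
  by rewrite h1 h2 subrr mulr0.
rewrite -[LHS](telescope_sumr (fun i => g (grid s i)) (leq0n j)).
apply: eq_big_nat => i /andP[_ ij].
by rewrite grid_homo// mul1r.
Qed.

(** Cells are closed on the right and contain no end point of [s] in their interior, so on a
    nonempty cell the step function equals its value at the right end. *)
Definition grid_coef s i : R := step_fun s (grid s i.+1).

(** The function [g] is arbitrary because two choices are made: a path of [B] yields the step
    integral, and the indicator of x <= y, as a function of y, yields the step function at x. *)
Lemma step_grid s (g : R -> R) : step_on_half_line s ->
  \sum_(q <- s) q.1.1 * (g q.2 - g q.1.2) =
  \sum_(i < size (grid_points s))
    grid_coef s i * (g (grid s i.+1) - g (grid s i)).
Proof.
move=> /allP hs.
under [RHS]eq_bigr do rewrite /grid_coef /step_fun mulr_suml.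
rewrite exchange_big/= !big_seq; apply: eq_bigr => q qs.
have /andP[a0 ab] := hs _ qs.
have aP : q.1.2 \in grid_points s.
  by rewrite mem_sort mem_cat; apply/orP; left; apply/mapP; exists q.
have bP : q.2 \in grid_points s.
  by rewrite mem_sort mem_cat; apply/orP; right; apply/mapP; exists q.
have [ja jaN aE] := mem_grid aP; have [jb jbN bE] := mem_grid bP.
under [RHS]eq_bigr do rewrite -mulrA.
rewrite -mulr_sumr; congr (_ * _).
rewrite (_ : g q.2 - g q.1.2 =
  (g q.2 - g (grid s 0)) - (g q.1.2 - g (grid s 0))); last by ring.
rewrite aE bE (grid_telescope s g jaN) (grid_telescope s g jbN) -sumrB -aE -bE.
apply: eq_bigr => i _; rewrite -mulrBl; congr (_ * _).
rewrite indicE mem_setE in_itv/=.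
have [h1|h1] := leP (grid s i.+1) q.1.2.
  by rewrite (le_trans h1 ab) subrr.
by rewrite subr0.
Qed.

Lemma step_fun_grid s x : step_on_half_line s ->
  step_fun s x = \sum_(i < size (grid_points s))
    grid_coef s i * \1_`]grid s i, grid s i.+1] x.
Proof.
move=> hs.
have oc a b : a <= b -> \1_`]a, b] x = (x <= b)%R%:R - (x <= a)%R%:R :> R.
  move=> ab; rewrite indicE mem_setE in_itv/=.
  have [h1|h1] := leP x a; first by rewrite (le_trans h1 ab) subrr.
  by rewrite subr0.
transitivity (\sum_(q <- s) q.1.1 * ((x <= q.2)%R%:R - (x <= q.1.2)%R%:R)).
  rewrite /step_fun !big_seq; apply: eq_bigr => q qs; rewrite oc//.
  by have /allP/(_ _ qs)/andP[] := hs.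
rewrite (step_grid (fun y => (x <= y)%R%:R) hs).
by apply: eq_bigr => i _; rewrite oc// grid_homo.
Qed.

(** The cells are disjoint, so the cross terms vanish. *)
Lemma sqr_step_fun_grid s x : step_on_half_line s ->
  step_fun s x ^+ 2 = \sum_(i < size (grid_points s))
    grid_coef s i ^+ 2 * \1_`]grid s i, grid s i.+1] x.
Proof.
move=> hs; rewrite step_fun_grid//; elim: (size _) => [|n IH].
  by rewrite !big_ord0 expr0n.
rewrite !big_ord_recr/= sqrrD IH exprMn.
have -> : (\sum_(i < n) grid_coef s i * \1_`]grid s i, grid s i.+1] x) *
   (grid_coef s n * \1_`]grid s n, grid s n.+1] x) = 0.
  rewrite mulr_suml big1// => i _.
  rewrite !indicE !mem_setE !in_itv/=.
  have [h|h] := leP x (grid s n); first by rewrite !mulr0.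
  suff -> : (x <= grid s i.+1) = false by rewrite andbF mulr0 mul0r.
  apply/negbTE; rewrite -ltNge; apply: le_lt_trans h; exact: grid_homo.
rewrite mul0rn addr0; congr (_ + _ * _).
by rewrite indicE; case: (_ \in _); rewrite ?expr1n ?expr0n.
Qed.

(** This number is both the L^2 norm of the step function and the standard deviation of its
    integral: the Ito isometry for steps. *)
Definition step_norm s : R := Num.sqrt (\sum_(i < size (grid_points s))
  grid_coef s i ^+ 2 * (grid s i.+1 - grid s i)).

Lemma Lnorm_step_fun s : step_on_half_line s ->
  Lnorm mu 2%:E (EFin \o step_fun s) = (step_norm s)%:E.
Proof.
move=> hs; rewrite unlock.
transitivity ((\int[mu]_x (\sum_(i < size (grid_points s))
    (grid_coef s i ^+ 2)%:E * (\1_`]grid s i, grid s i.+1] x)%:E)) `^ 2^-1)%E.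
  congr (_ `^ _)%E; apply: eq_integral => x _ /=.
  rewrite powR_mulrn// -normrX ger0_norm ?sqr_ge0// sqr_step_fun_grid//.
  by rewrite -sumEFin; apply: eq_bigr => i _; rewrite EFinM.
rewrite ge0_integral_sum//=; last 2 first.
- by move=> i; apply/measurable_EFinP; exact: measurable_funM.
- by move=> i x _; rewrite lee_fin mulr_ge0// ?sqr_ge0// indicE.
have int_step i : (\int[mu]_x ((grid_coef s i ^+ 2)%:E *
    (\1_`]grid s i, grid s i.+1] x)%:E) =
    (grid_coef s i ^+ 2 * (grid s i.+1 - grid s i))%:E)%E.
  rewrite ge0_integralZl//=; [|exact/measurable_EFinP|by rewrite lee_fin sqr_ge0].
  rewrite integral_indic//= setIT.
  have := lebesgue_measure_itv `]grid s i, grid s i.+1]; rewrite /= => ->.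
  rewrite lte_fin [RHS]EFinM; congr (_ * _)%E;
  case: ifPn => [_|]; first by rewrite EFinB.
  rewrite -leNgt => h; have -> : grid s i.+1 = grid s i.
    by apply/eqP; rewrite eq_le h grid_homo.
  by rewrite subrr.
under eq_bigr do rewrite int_step.
rewrite sumEFin poweR_EFin /step_norm -powR12_sqrt//.
by apply: sumr_ge0 => i _; rewrite mulr_ge0 ?sqr_ge0// subr_ge0 grid_homo.
Qed.

Lemma step_integral_gaussian s : step_on_half_line s ->
  centered_gaussian P (step_integral B s) (step_norm s).
Proof.
move=> hs; set n := size (grid_points s).
pose Y i : {RV P >-> R} := grid_coef s i \o* (B (grid s i.+1) \- B (grid s i)).
have grid_ge0 i : 0 <= grid s i.
  by apply: le_trans (grid0_ge0 hs) _; exact: grid_homo.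
have -> : step_integral B s = partial_sum Y n.
  apply/funext => w; rewrite /step_integral (step_grid (B ^~ w) hs).
  by apply: eq_bigr => i _ /=; rewrite mulrC.
pose b i : R := `|grid_coef s i| * Num.sqrt (grid s i.+1 - grid s i).
have -> : step_norm s = Num.sqrt (\sum_(i < n) b i ^+ 2).
  congr Num.sqrt; apply: eq_bigr => i _.
  by rewrite exprMn real_normK ?num_real// sqr_sqrtr// subr_ge0 grid_homo.
apply: (gaussian_sum hB) => [D mD|i _]; last first.
  apply: centered_gaussianZ; apply: brownian_increment_gaussian => //.
  exact: grid_homo.
(* Coefficients are moved into the sets, since independence is given for the bare increments. *)
pose C (i : nat) : set R := ( *%R (grid_coef s i)) @^-1` D i.
have mC i : measurable (C i).
  by rewrite -(setTI (C i)); exact: mulrl_measurable.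
have YC i : Y i @^-1` D i = (B (grid s i.+1) \- B (grid s i)) @^-1` C i.
  by apply/seteqP; split => w; rewrite /Y /C /preimage /= mulrC.
have := brownian_increments_independent hB (grid0_ge0 hs) (@grid_homo s)
  (n := n) (A := fun i : 'I_n => C i) (fun i => mC i).
have -> : \bigcap_(i in `I_n) (Y i @^-1` D i) =
    \bigcap_i ((fun i : 'I_n => B (grid s i.+1) \- B (grid s i)) i @^-1` C i).
  apply/seteqP; split => w.
    by move=> H i _; rewrite -YC; exact: H (ltn_ord i).
  by move=> H i /= i_n; suff : (Y i @^-1` D i) w by [];
    rewrite (YC i); exact: (H (Ordinal i_n)).
by move=> ->; apply: eq_bigr => i _; rewrite YC.
Qed.

End step_integral.

Section measurable_norm.
Context {R : realType} {d : measure_display} {T : measurableType d}.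

Lemma measurable_norm_ge (f : T -> R) (x : R) : measurable_fun setT f ->
  measurable [set w | x <= `|f w|].
Proof.
move=> mf; rewrite -(setTI [set _ | _]); apply: measurable_fun_le => //.
exact: measurableT_comp.
Qed.

Lemma measurable_norm_le (f : T -> R) (x : R) : measurable_fun setT f ->
  measurable [set w | `|f w| <= x].
Proof.
move=> mf; rewrite -(setTI [set _ | _]); apply: measurable_fun_le => //.
exact: measurableT_comp.
Qed.

End measurable_norm.

(** * Tail and small ball estimates for normal laws *)

Section normal_estimates.
Context {R : realType}.
Implicit Types s x m L : R.
Local Notation mu := (@lebesgue_measure R).

Let measurable_pdf s (D : set R) : measurable_fun D (fun x => (normal_pdf 0 s x)%:E).
Proof.
by apply/measurable_EFinP; apply: measurable_funTS; exact: measurable_normal_pdf.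
Qed.

(* The density of standard deviation [s] is [sqrt 2 * exp (- x ^ 2 / (4 s ^ 2))]
   times the one of standard deviation [sqrt 2 * s]. *)
Lemma normal_prob_tail s x : 0 < s -> 0 <= x ->
  (normal_prob 0 s [set y : R | (x <= `|y|)%R] <=
   (2 * expR (- (x ^+ 2 / (4 * s ^+ 2))))%:E)%E.
Proof.
move=> s0 x0; set c := 2 * expR _.
have c0 : 0 <= c by rewrite mulr_ge0// expR_ge0.
have mA : measurable [set y : R | (x <= `|y|)%R].
  exact: measurable_norm_ge.
pose s2 := Num.sqrt 2 * s.
have sqrt20 : 0 < Num.sqrt 2 :> R by rewrite sqrtr_gt0.
have s20 : 0 < s2 by rewrite mulr_gt0.
have sqr2 : Num.sqrt 2 ^+ 2 = 2 :> R by rewrite sqr_sqrtr.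
have sqrt2_le : Num.sqrt 2 <= 2 :> R.
  rewrite -[leRHS]ger0_norm// -sqrtr_sqr ler_sqrt ?exprn_ge0//; lra.
rewrite /normal_prob.
apply: (@le_trans _ _ (\int[mu]_(y in [set y : R | (x <= `|y|)%R])
   (c%:E * (normal_pdf 0 s2 y)%:E)))%E.
  apply: ge0_le_integral => //=.
  - by move=> y _; rewrite lee_fin normal_pdf_ge0.
  - exact: measurable_pdf.
  - by apply: measurable_funeM; exact: measurable_pdf.
  move=> y /= xy; rewrite -EFinM lee_fin !normal_pdfE ?gt_eqF//.
  have -> : normal_peak s = Num.sqrt 2 * normal_peak s2.
    rewrite /normal_peak /s2.
    have -> : (Num.sqrt 2 * s) ^+ 2 * pi *+ 2 =
        Num.sqrt 2 ^+ 2 * (s ^+ 2 * pi *+ 2) :> R.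
      by rewrite exprMn -!mulrnAr -!mulrA.
    rewrite (sqrtrM _ (sqr_ge0 _)) sqrtr_sqr gtr0_norm//.
    by rewrite invfM mulrA divff ?gt_eqF// mul1r.
  have -> : normal_fun 0 s y = expR (- (y ^+ 2 / (4 * s ^+ 2))) * normal_fun 0 s2 y.
    rewrite /normal_fun -expRD; congr expR.
    rewrite subr0 /s2 exprMn sqr2; field.
    by rewrite gt_eqF.
  rewrite mulrACA ler_wpM2r ?mulr_ge0 ?normal_peak_ge0 ?expR_ge0// /c.
  apply: ler_pM; rewrite ?expR_ge0 ?sqrtr_ge0// ler_expR lerN2.
  rewrite ler_wpM2r ?invr_ge0 ?mulr_ge0 ?sqr_ge0 ?(ltW s0)//.
  by rewrite -(real_normK (num_real (y : R))) ler_sqr ?nnegrE.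
rewrite ge0_integralZl//=; [|exact: measurable_pdf|].
  rewrite -[leRHS]mule1; apply: lee_pmul => //.
    by apply: integral_ge0 => y _; rewrite lee_fin normal_pdf_ge0.
  exact: (@probability_le1 _ _ _ (normal_prob 0 s2)).
by move=> y _; rewrite lee_fin normal_pdf_ge0.
Qed.

(** The density is at most 1 / s and the interval has length 2 L. The bound does not depend on the
    centre, so an unknown mean does not affect it. *)
Lemma normal_prob_small_ball s m L : 0 < s -> 0 <= L ->
  (normal_prob 0 s [set y : R | (`|y + m| <= L)%R] <= (2 * L / s)%:E)%E.
Proof.
move=> s0 L0.
have -> : [set y : R | (`|y + m| <= L)%R] = `[- L - m, L - m]%classic.
  apply/seteqP; split => y /=; rewrite in_itv/= ler_norml.
    by move=> /andP[h1 h2]; apply/andP; split; lra.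
  by move=> /andP[h1 h2]; apply/andP; split; lra.
rewrite /normal_prob.
apply: (@le_trans _ _
  (\int[mu]_(y in `[(- L - m)%R, (L - m)%R]) (cst (s^-1)%:E y)))%E.
  apply: ge0_le_integral => //=.
  - by move=> y _; rewrite lee_fin normal_pdf_ge0.
  - exact: measurable_pdf.
  move=> y _; rewrite lee_fin (le_trans (normal_pdf_ub _ _ _)) ?gt_eqF//.
  rewrite /normal_peak lef_pV2 ?posrE ?sqrtr_gt0//; last first.
    by rewrite -mulr_natr !mulr_gt0 ?exprn_gt0 ?pi_gt0.
  rewrite -[leLHS](gtr0_norm s0) -sqrtr_sqr ler_wsqrtr//.
  rewrite -mulr_natr -mulrA ler_peMr ?sqr_ge0//.
  by have := pi_ge2 R; lra.
rewrite integral_cst//= lebesgue_measure_itv/= lte_fin.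
case: ifPn => _; last by rewrite mule0 lee_fin divr_ge0 ?mulr_ge0// ltW.
by rewrite -EFinB -EFinM lee_fin mulrC ler_wpM2r ?invr_ge0 ?(ltW s0)//; lra.
Qed.

End normal_estimates.

(** * Gaussian estimates for L^2 limits *)

Section gaussian_limit.
Context {R : realType} {d : measure_display} {T : measurableType d}.
Variable P : probability T R.

Lemma centered_gaussian_tail (Y : {RV P >-> R}) (r s x : R) :
  centered_gaussian P Y r -> r <= s -> 0 < s -> 0 < x ->
  (P [set w | (x <= `|Y w|)%R] <= (2 * expR (- (x ^+ 2 / (4 * s ^+ 2))))%:E)%E.
Proof.
move=> [[_ Y0]|[r0 lawY]] rs s0 x0.
  rewrite (_ : [set w | _] = set0); last first.
    by apply/seteqP; split => w //=; rewrite Y0 normr0 leNgt x0.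
  by rewrite measure0 lee_fin mulr_ge0 ?expR_ge0.
have mA : measurable [set y : R | (x <= `|y|)%R].
  exact: measurable_norm_ge.
have -> : [set w | (x <= `|Y w|)%R] = Y @^-1` [set y : R | (x <= `|y|)%R] by [].
rewrite lawY//; apply: (le_trans (normal_prob_tail r0 (ltW x0))).
rewrite lee_fin ler_wpM2l// ler_expR lerN2 ler_wpM2l ?sqr_ge0//.
rewrite lef_pV2 ?posrE ?mulr_gt0 ?exprn_gt0// ler_wpM2l//.
by rewrite ler_sqr ?nnegrE ?(ltW r0) ?(ltW s0).
Qed.

Lemma centered_gaussian_small_ball (Y : {RV P >-> R}) (r m L : R) :
  centered_gaussian P Y r -> 0 < r -> 0 <= L ->
  (P [set w | (`|Y w + m| <= L)%R] <= (2 * L / r)%:E)%E.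
Proof.
move=> [[-> _]|[r0 lawY]]; first by rewrite ltxx.
move=> _ L0; have mA : measurable [set y : R | (`|y + m| <= L)%R].
  by apply: measurable_norm_le; exact: measurable_funD.
have -> : [set w | (`|Y w + m| <= L)%R] =
    Y @^-1` [set y : R | (`|y + m| <= L)%R] by [].
by rewrite lawY//; exact: normal_prob_small_ball.
Qed.

Lemma Lnorm2_cvg0_probability (Z : nat -> {RV P >-> R}) (delta e : R) :
  Lnorm P 2%:E (EFin \o Z n) @[n --> \oo] --> 0%E -> 0 < delta -> 0 < e ->
  \forall n \near \oo, (P [set w | (delta <= `|Z n w|)%R] <= e%:E)%E.
Proof.
move=> Z0 delta0 e0.
(* Chebyshev's inequality: a norm of at most delta sqrt(e) leaves probability at most e beyond
   delta. *)
have de0 : 0 < delta * Num.sqrt e by rewrite mulr_gt0// sqrtr_gt0.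
have /fine_cvgP[Zfin Zcvg] := Z0.
near=> n.
have Nfin : Lnorm P 2%:E (EFin \o Z n) \is a fin_num by near: n.
have Nle : (Lnorm P 2%:E (EFin \o Z n) <= (delta * Num.sqrt e)%:E)%E.
  rewrite -(fineK Nfin) lee_fin; apply: ltW.
  have : `|0 - fine (Lnorm P 2%:E (EFin \o Z n))| < delta * Num.sqrt e.
    by near: n; move/cvgrPdist_lt : Zcvg; exact.
  by rewrite sub0r normrN; apply: le_lt_trans; exact: ler_norm.
have := @markov _ _ _ P (Z n) (fun x => x ^+ 2) delta delta0.
rewrite unlock.
have -> : (\int[P]_w (((fun x : R => x ^+ 2) \o (fun x : R => `|x|) \o Z n) w)%:E =
    Lnorm P 2%:E (EFin \o Z n) `^ 2)%E.
  rewrite poweR_Lnorm//; apply: eq_integral => w _ /=.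
  by rewrite powR_mulrn.
move=> H.
have {}H : ((delta ^+ 2)%:E * P [set w | (delta%:E <= `|(Z n w)%:E|)%E] <=
    (delta ^+ 2)%:E * e%:E)%E.
  apply: (le_trans (H _ _ _)).
  - exact: measurable_funX.
  - by move=> r _; exact: sqr_ge0.
  - by move=> x y; rewrite !nnegrE => x0' y0'; rewrite ler_sqr.
  rewrite -(fineK Nfin) poweR_EFin -EFinM lee_fin powR_mulrn ?fine_ge0 ?Lnorm_ge0//.
  rewrite -[X in _ <= _ * X](sqr_sqrtr (ltW e0)) -exprMn.
  rewrite ler_sqr ?nnegrE ?fine_ge0 ?Lnorm_ge0 ?(ltW de0)//.
  by rewrite -lee_fin fineK.
by move: H; rewrite lee_pmul2l ?lte_fin ?exprn_gt0.
Unshelve. all: by end_near. Qed.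

Variables (Y : {RV P >-> R}) (S : nat -> {RV P >-> R}) (r : nat -> R) (v : R).
Hypothesis gS : forall n, centered_gaussian P (S n) (r n).
Hypothesis r_cvg : r n @[n --> \oo] --> v.
Hypothesis S_cvg : Lnorm P 2%:E (EFin \o (Y \- S n)) @[n --> \oo] --> 0%E.

Let measurable_tail (Z : {RV P >-> R}) x : measurable [set w | x <= `|Z w|].
Proof.
exact: measurable_norm_ge.
Qed.

(* Halving [x] and doubling [s] leaves room for both approximations. *)
Lemma gaussian_limit_tail (s x : R) : v <= s -> 0 < s -> 0 < x ->
  (P [set w | (x <= `|Y w|)%R] <= (2 * expR (- (x ^+ 2 / (64 * s ^+ 2))))%:E)%E.
Proof.
move=> vs s0 x0; apply/lee_addgt0Pr => e e0.
have x20 : 0 < x / 2 by lra.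
have s20 : 0 < 2 * s by lra.
near \oo => n.
have h1 : (P [set w | (x / 2 <= `|(Y \- S n) w|)%R] <= e%:E)%E.
  near: n; exact: (@Lnorm2_cvg0_probability (fun n => Y \- S n)%R _ _ S_cvg x20 e0).
have h2 : r n <= 2 * s.
  apply: ltW; near: n; apply: (cvgr_lt v r_cvg); lra.
have h3 := centered_gaussian_tail (gS n) h2 s20 x20.
have -> : x ^+ 2 / (64 * s ^+ 2) = (x / 2) ^+ 2 / (4 * (2 * s) ^+ 2).
  by field; rewrite gt_eqF.
apply: le_trans (leeD h3 h1).
apply: le_trans (measureU2 _ _ _); [|exact: measurable_tail..].
apply: le_measure; rewrite ?inE//.
  by apply: measurableU; exact: measurable_tail.
move=> w /= xY; have [h|h] := leP (x / 2) `|S n w|; first by left.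
right; have := ler_normD (Y w - S n w) (S n w); rewrite subrK; lra.
Unshelve. all: by end_near. Qed.

(** Enlarging [L] to 2 L absorbs the error [Y - S n], and eventually [r n] is at least v / 2. The
    estimate for [S n] then reads 2 (2 L) / (v / 2) = 8 L / v. *)
Lemma gaussian_limit_small_ball (m L : R) : 0 < v -> 0 < L ->
  (P [set w | (`|Y w + m| <= L)%R] <= (8 * L / v)%:E)%E.
Proof.
move=> v0 L0; apply/lee_addgt0Pr => e e0.
near \oo => n.
have h1 : (P [set w | (L <= `|(Y \- S n) w|)%R] <= e%:E)%E.
  near: n; exact: (@Lnorm2_cvg0_probability (fun n => Y \- S n)%R _ _ S_cvg L0 e0).
have h2 : v / 2 <= r n.
  apply: ltW; near: n; apply: (cvgr_gt v r_cvg); lra.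
have rn0 : 0 < r n by lra.
have L20 : 0 <= 2 * L by lra.
have h3 := centered_gaussian_small_ball m (gS n) rn0 L20.
have h4 : (P [set w | (`|S n w + m| <= 2 * L)%R] <= (8 * L / v)%:E)%E.
  apply: (le_trans h3); rewrite lee_fin ler_pdivrMr//.
  have Lv : 0 <= 8 * L / v by rewrite divr_ge0 ?mulr_ge0// ltW.
  apply: (le_trans _ (ler_wpM2l Lv h2)).
  have -> : 8 * L / v * (v / 2) = 4 * L by field; rewrite gt_eqF.
  lra.
have mball (Z : {RV P >-> R}) l : measurable [set w | `|Z w + m| <= l].
  by apply: measurable_norm_le; exact: measurable_funD.
apply: le_trans (leeD h4 h1).
apply: le_trans (measureU2 _ _ _); [|exact: mball|exact: measurable_tail].
apply: le_measure; rewrite ?inE//.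
  by apply: measurableU; [exact: mball|exact: measurable_tail].
move=> w /= xY; have [h|h] := leP L `|Y w - S n w|; first by right.
left; have := ler_normB (Y w + m) (Y w - S n w).
by rewrite (_ : Y w + m - (Y w - S n w) = S n w + m); [lra|ring].
Unshelve. all: by end_near. Qed.

End gaussian_limit.

(** * Convergence in the L^2 norm *)

Section Lnorm2_convergence.
Context {R : realType} {d : measure_display} {T : measurableType d}.
Variable mu : {measure set T -> \bar R}.
Local Notation "'N2 f" := (Lnorm mu 2%:E (EFin \o f)) (at level 10, f at level 9).

Lemma Lnorm2_triangleB (f g : T -> R) : measurable_fun setT f ->
  measurable_fun setT g -> ('N2 (f \- g)%R <= 'N2 f + 'N2 g)%E.
Proof.
move=> mf mg; have mNg : measurable_fun setT (\- g)%R by exact: measurable_funN.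
have -> : 'N2 g = 'N2 (\- g)%R.
  by rewrite -oppe_Lnorm; apply: eq_Lnorm.
exact: (minkowski_EFin mu mf mNg (ler1n _ 2)).
Qed.

Lemma Lnorm2_cvg0B (f g : nat -> T -> R) :
  (forall n, measurable_fun setT (f n)) -> (forall n, measurable_fun setT (g n)) ->
  'N2 (f n) @[n --> \oo] --> 0%E -> 'N2 (g n) @[n --> \oo] --> 0%E ->
  'N2 (f n \- g n)%R @[n --> \oo] --> 0%E.
Proof.
move=> mf mg f0 g0.
apply: (@squeeze_cvge _ \oo _ _ (cst 0%E) _ (fun n => 'N2 (f n) + 'N2 (g n))%E).
- by near=> n; rewrite Lnorm_ge0/= Lnorm2_triangleB.
- exact: cvg_cst.
- by rewrite -[X in _ --> X]adde0; apply: cvgeD.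
Unshelve. all: by end_near. Qed.

(** Reverse triangle inequality. Applied to the step functions, it gives the limit of the standard
    deviations of their integrals. *)
Lemma Lnorm2_cvg (f : T -> R) (g : nat -> T -> R) (v : R) (r : nat -> R) :
  measurable_fun setT f -> (forall n, measurable_fun setT (g n)) ->
  'N2 f = v%:E -> (forall n, 'N2 (g n) = (r n)%:E) ->
  'N2 (f \- g n)%R @[n --> \oo] --> 0%E ->
  r n @[n --> \oo] --> v.
Proof.
move=> mf mg Nf Ng fg0.
have /fine_cvgP[fin cvg0] := fg0.
apply/cvgrPdist_le => e e0.
near=> n.
have fgfin : 'N2 (f \- g n)%R \is a fin_num by near: n.
have fgle : fine ('N2 (f \- g n)%R) <= e.
  have : `|0 - fine ('N2 (f \- g n)%R)| <= e.
    by near: n; move/cvgrPdist_le : cvg0; exact.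
  by rewrite sub0r normrN; apply: le_trans; exact: ler_norm.
have mfg : measurable_fun setT (f \- g n)%R by exact: measurable_funB.
have h1 : ('N2 (g n) <= 'N2 f + 'N2 (f \- g n)%R)%E.
  have -> : g n = (f \- (f \- g n))%R by apply/funext => x /=; ring.
  have -> : (f \- (f \- (f \- g n)))%R = (f \- g n)%R by apply/funext => x /=; ring.
  exact: Lnorm2_triangleB.
have h2 : ('N2 f <= 'N2 (f \- g n)%R + 'N2 (g n))%E.
  have {1}-> : f = ((f \- g n) \+ g n)%R by apply/funext => x /=; ring.
  exact: (minkowski_EFin mu mfg (mg n) (ler1n _ 2)).
move: h1 h2; rewrite Ng Nf -(fineK fgfin) -!EFinD !lee_fin => h1 h2.
by rewrite ler_distl; apply/andP; split; lra.
Unshelve. all: by end_near. Qed.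

End Lnorm2_convergence.

(** * Increments of the Wiener integral *)

Section wiener_increment.
Context {R : realType} {d : measure_display} {T : measurableType d}.
Variable P : probability T R.
Variables (B W : R -> {RV P >-> R}) (eta : R -> R).
Hypothesis hB : brownian_motion B.
Hypothesis heta : eta \_ (@nonneg_half_line R) \in Lfun (@lebesgue_measure R) 2%:E.
Hypothesis hW : forall t, 0 <= t -> wiener_integral_of B (eta \_ `[0, t]) (W t).
Local Notation mu := (@lebesgue_measure R).

Definition sqr_integral (f : R -> R) (t : R) : R :=
  (\int[@lebesgue_measure R]_(u in `[0%R, t]) (f u ^+ 2))%R.

Local Notation phi := (sqr_integral eta).

Lemma half_lineE : @nonneg_half_line R = `[0, +oo[%classic. Proof. by []. Qed.

Lemma itv_sub_half_line (t : R) : `[0, t] `<=` @nonneg_half_line R.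
Proof. by move=> x; rewrite half_lineE /= !in_itv/= andbT => /andP[]. Qed.

Lemma measurable_eta t : measurable_fun setT (eta \_ `[0, t]).
Proof.
have mhl : measurable (@nonneg_half_line R) by rewrite half_lineE.
have mt : measurable (`[0, t] : set R) by [].
apply: (measurable_restrictT eta mt).1.
apply: (measurable_funS mhl (@itv_sub_half_line t)).
apply: (measurable_restrictT eta mhl).2.
by have := heta; rewrite inE => /andP[/[!inE]].
Qed.

Lemma integrable_eta2 t : mu.-integrable `[0, t] (EFin \o (fun u => eta u ^+ 2)).
Proof.
have H : mu.-integrable `[0, t]
    (EFin \o (fun x => (eta \_ (@nonneg_half_line R)) x ^+ 2)).
  exact: integrableS (Lfun2_integrable_sqr heta).
apply: eq_integrable H => // x /[!inE] xt /=; rewrite patchE ifT// inE.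
exact: itv_sub_half_line xt.
Qed.

Lemma sqr_integralB u t : 0 <= u -> u <= t ->
  phi t - phi u = (\int[mu]_(x in `]u, t]) (eta x ^+ 2))%R.
Proof.
move=> u0 ut.
by rewrite -(@Rintegral_itvB _ _ (BLeft 0) (BRight t) u)//; exact: integrable_eta2.
Qed.

Lemma sqr_integral_homo u t : 0 <= u -> u <= t -> phi u <= phi t.
Proof.
move=> u0 ut; rewrite -subr_ge0 sqr_integralB//.
by apply: Rintegral_ge0 => x _; exact: sqr_ge0.
Qed.

Lemma sqr_integral_ge0 t : 0 <= phi t.
Proof. by apply: Rintegral_ge0 => x _; exact: sqr_ge0. Qed.

Lemma sqr_integral0 : phi 0 = 0.
Proof. by rewrite /sqr_integral set_itv1 Rintegral_set1. Qed.

Lemma sqr_integral_continuous K : 0 <= K -> {within `[0, K], continuous phi}.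
Proof.
move=> K0; exact: (parameterized_integral_continuous K0 (@integrable_eta2 K)).
Qed.

Lemma Lnorm2_restriction u t : 0 <= u -> u <= t ->
  Lnorm mu 2%:E (EFin \o (eta \_ `[0, t] \- eta \_ `[0, u])) =
  (Num.sqrt (phi t - phi u))%:E.
Proof.
move=> u0 ut; rewrite unlock sqr_integralB//.
have itvE x : (eta \_ `[0, t] \- eta \_ `[0, u]) x = (eta \_ `]u, t]) x.
  rewrite /= !patchE !mem_setE !in_itv/=.
  have [xu|xu] := leP x u.
    rewrite (le_trans xu ut) !andbT/=.
    by case: (0 <= x) => /=; rewrite subrr.
  by rewrite andbF subr0 (le_trans u0 (ltW xu)).
transitivity ((\int[mu]_(x in `]u, t]) (eta x ^+ 2)%:E) `^ 2^-1)%E.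
  congr (_ `^ _)%E; rewrite [RHS]integral_mkcond; apply: eq_integral => x _.
  rewrite [in LHS]/comp itvE !patchE; case: ifPn => _ /=.
    by rewrite powR_mulrn// -normrX ger0_norm ?sqr_ge0.
  by rewrite normr0 powR0.
have int2 : mu.-integrable `]u, t] (EFin \o (fun x => eta x ^+ 2)).
  apply: integrableS (integrable_eta2 t) => //.
  by move=> x /=; rewrite !in_itv/= => /andP[/ltW/(le_trans u0) -> ->].
rewrite /Rintegral -[in LHS](fineK (integrable_fin_num _ int2))//.
by rewrite poweR_EFin -powR12_sqrt// Rintegral_ge0// => x _; exact: sqr_ge0.
Qed.

(** Concatenating with negated coefficients subtracts both the step functions and the step
    integrals, so that an increment is approximated by single step integrals. *)
Let opp_steps (s : seq (R * R * R)) := [seq (- q.1.1, q.1.2, q.2) | q <- s].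

Let step_fun_catN s1 s2 : step_fun (s1 ++ opp_steps s2) = step_fun s1 \- step_fun s2.
Proof.
apply/funext => x; rewrite /step_fun big_cat big_map/=; congr (_ + _).
by rewrite -sumrN; apply: eq_bigr => q _; rewrite mulNr.
Qed.

Let step_integral_catN s1 s2 : step_integral B (s1 ++ opp_steps s2) =
  step_integral B s1 \- step_integral B s2.
Proof.
apply/funext => x; rewrite /step_integral big_cat big_map/=; congr (_ + _).
by rewrite -sumrN; apply: eq_bigr => q _; rewrite mulNr.
Qed.

Lemma measurable_step_integral s : measurable_fun setT (step_integral B s).
Proof.
apply: measurable_sum => q; apply: measurable_funM => //.
exact: measurable_funB.
Qed.

Lemma measurable_step_fun (s : seq (R * R * R)) : measurable_fun setT (step_fun s).
Proof. by apply: measurable_sum => q; exact: measurable_funM. Qed.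

Lemma wiener_increment_limit u t : 0 <= u -> u <= t ->
  exists (S : nat -> {RV P >-> R}) (r : nat -> R),
    [/\ forall n, centered_gaussian P (S n) (r n),
        r n @[n --> \oo] --> Num.sqrt (phi t - phi u)
      & Lnorm P 2%:E (EFin \o ((W t \- W u) \- S n)) @[n --> \oo] --> 0%E].
Proof.
move=> u0 ut; have t0 := le_trans u0 ut.
have [st [st_step st_fun st_int]] := hW t0.
have [su [su_step su_fun su_int]] := hW u0.
pose s n := st n ++ opp_steps (su n).
have s_step n : step_on_half_line (s n).
  by rewrite /step_on_half_line all_cat all_map; apply/andP; split;
    [exact: st_step|exact: su_step].
pose S n : {RV P >-> R} := HB.pack (step_integral B (s n))
  (isMeasurableFun.Build _ _ _ _ _ (@measurable_step_integral (s n))).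
exists S, (fun n => step_norm (s n)); split.
- by move=> n; exact: step_integral_gaussian.
- apply: (Lnorm2_cvg (mu := mu) _ _ (Lnorm2_restriction u0 ut)).
  + by apply: measurable_funB; exact: measurable_eta.
  + by move=> n; exact: (@measurable_step_fun (s n)).
  + by move=> n; exact: Lnorm_step_fun.
  have mt n : measurable_fun [set: measurableTypeR R]
      (eta \_ `[0, t] \- step_fun (st n)).
    by apply: measurable_funB; [exact: measurable_eta|exact: measurable_step_fun].
  have mu' n : measurable_fun [set: measurableTypeR R]
      (eta \_ `[0, u] \- step_fun (su n)).
    by apply: measurable_funB; [exact: measurable_eta|exact: measurable_step_fun].
  apply: cvg_trans (Lnorm2_cvg0B mt mu' st_fun su_fun).
  apply: near_eq_cvg; near=> n; apply: eq_Lnorm => x /=.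
  by rewrite /s step_fun_catN/=; congr EFin; ring.
- have mt n : measurable_fun setT (W t \- step_integral B (st n)).
    by apply: measurable_funB => //; exact: measurable_step_integral.
  have mu' n : measurable_fun setT (W u \- step_integral B (su n)).
    by apply: measurable_funB => //; exact: measurable_step_integral.
  apply: cvg_trans (Lnorm2_cvg0B mt mu' st_int su_int).
  apply: near_eq_cvg; near=> n; apply: eq_Lnorm => x /=.
  by rewrite /s step_integral_catN/=; congr EFin; ring.
Unshelve. all: by end_near. Qed.

Lemma wiener_increment_tail u t s x : 0 <= u -> u <= t ->
  phi t - phi u <= s ^+ 2 -> 0 < s -> 0 < x ->
  (P [set w | (x <= `|W t w - W u w|)%R] <=
   (2 * expR (- (x ^+ 2 / (64 * s ^+ 2))))%:E)%E.
Proof.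
move=> u0 ut vs s0 x0.
have [S [r [gS rv SW]]] := wiener_increment_limit u0 ut.
apply: (gaussian_limit_tail gS rv SW) => //.
by rewrite -(gtr0_norm s0) -sqrtr_sqr ler_wsqrtr.
Qed.

Lemma wiener_increment_small_ball u t m L : 0 <= u -> u <= t ->
  phi u < phi t -> 0 < L ->
  (P [set w | (`|W t w - W u w + m| <= L)%R] <=
   (8 * L / Num.sqrt (phi t - phi u))%:E)%E.
Proof.
move=> u0 ut uvt L0.
have [S [r [gS rv SW]]] := wiener_increment_limit u0 ut.
apply: (gaussian_limit_small_ball gS rv SW) => //.
by rewrite sqrtr_gt0 subr_gt0.
Qed.

End wiener_increment.

(** * From likely paths to deterministic bounds *)

Section nonnegligible.
Context {R : realType} {d : measure_display} {T : measurableType d}.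
Variable P : probability T R.

(** Otherwise [A] would lie in members of [F] of arbitrarily small probability, hence in their null
    intersection. [A] itself may fail to be measurable. *)
Lemma nonnegligible_lower_bound (A : set T) (F : set (set T)) :
  ~ P.-negligible A ->
  (forall M, F M -> measurable M /\ A `<=` M) ->
  exists2 p : R, 0 < p & forall M, F M -> (p%:E <= P M)%E.
Proof.
move=> nA FA; apply: contrapT => H.
have {}H k : exists M, F M /\ (P M < (k.+1%:R^-1)%:E)%E.
  apply: contrapT => Hk; apply: H; exists k.+1%:R^-1; first by rewrite invr_gt0.
  by move=> M FM; rewrite leNgt; apply/negP => PM; apply: Hk; exists M.
have [M HM] := choice H.
apply: nA; exists (\bigcap_k M k); split.
- by apply: bigcapT_measurable => k; have [/FA[]] := HM k.
- apply/eqP; rewrite eq_le measure_ge0 andbT.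
  apply/lee_addgt0Pr => e e0; rewrite add0e.
  have [k ke] : exists k, k.+1%:R^-1 < e.
    exists (Num.bound e^-1); rewrite invf_plt ?posrE//.
    apply: (lt_le_trans (archi_boundP _)); first by rewrite invr_ge0 ltW.
    by rewrite ler_nat.
  apply: (@le_trans _ _ (P (M k))).
    apply: le_measure; rewrite ?inE.
    + by apply: bigcapT_measurable => i; have [/FA[]] := HM i.
    + by have [/FA[]] := HM k.
    + exact: bigcap_inf.
  by apply: ltW; apply: (lt_trans (HM k).2); rewrite lte_fin.
- by move=> w Aw k _; have [FM _] := HM k; exact: (FA _ FM).2.
Qed.

End nonnegligible.

Section upper_bound.
Context {R : realType} {d : measure_display} {T : measurableType d}.
Variable P : probability T R.
Variables (B W : R -> {RV P >-> R}) (eta psi : R -> R) (X : R -> T -> R).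
Hypothesis hB : brownian_motion B.
Hypothesis heta : eta \_ (@nonneg_half_line R) \in Lfun (@lebesgue_measure R) 2%:E.
Hypothesis hW : forall t, 0 <= t -> wiener_integral_of B (eta \_ `[0, t]) (W t).
Hypothesis hX : forall t, 0 <= t -> forall w, X t w = W t w + psi t.
Local Notation phi := (sqr_integral eta).

(** The small ball estimate bounds the variance, whatever the mean. Once the variance is bounded, a
    larger |m| would require W_t - W_u to be at least |m| - L in modulus, an event that the tail
    estimate makes less likely than [p]. *)
Lemma likely_increment_bounds u t m L p : 0 <= u -> u <= t -> 0 < L -> 0 < p ->
  (p%:E <= P [set w | (`|W t w - W u w + m| <= L)%R])%E ->
  phi t - phi u <= (8 * L / p) ^+ 2 /\
  `|m| <= (1 + Num.sqrt (128 / p) * 8 / p) * L.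
Proof.
move=> u0 ut L0 p0 pP.
have s0 : 0 < 8 * L / p by rewrite divr_gt0// mulr_gt0.
have v0 : 0 <= phi t - phi u by rewrite subr_ge0 sqr_integral_homo.
have vs : phi t - phi u <= (8 * L / p) ^+ 2.
  have [uvt|tvu] := ltP (phi u) (phi t); last first.
    by apply: (@le_trans _ _ 0); [rewrite subr_le0|exact: sqr_ge0].
  have := le_trans pP (wiener_increment_small_ball hB heta hW m u0 ut uvt L0).
  have q0 : 0 < Num.sqrt (phi t - phi u) by rewrite sqrtr_gt0 subr_gt0.
  rewrite lee_fin ler_pdivlMr// mulrC -ler_pdivlMr// => h.
  rewrite -(sqr_sqrtr v0) ler_sqr ?nnegrE//; exact: ltW.
split=> //; rewrite leNgt; apply/negP => mL.
(* This value turns the exponent l^2 / 64 of the tail into 2 / p, and 2 exp(- 2 / p) < p follows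
   from exp(x) >= 1 + x. *)
pose l := Num.sqrt (128 / p).
have p128 : 0 < 128 / p by rewrite divr_gt0.
have l0 : 0 < l by rewrite sqrtr_gt0.
have x0 : 0 < l * (8 * L / p) by rewrite mulr_gt0.
have tail := wiener_increment_tail hB heta hW u0 ut vs s0 x0.
have expE : (l * (8 * L / p)) ^+ 2 / (64 * (8 * L / p) ^+ 2) = 2 / p.
  rewrite exprMn (sqr_sqrtr (ltW p128)); field.
  by rewrite !gt_eqF.
move: tail; rewrite expE => tail.
have Plt : 2 * expR (- (2 / p)) < p.
  rewrite expRN -ltr_pdivlMl// -ltf_pV2 ?posrE ?invr_gt0 ?expR_gt0
    ?mulr_gt0 ?invr_gt0//.
  rewrite invrK invfM invrK.
  by apply: lt_le_trans (expR_ge1Dx _); rewrite ltrDr.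
have : (P [set w | (`|W t w - W u w + m| <= L)%R] <=
    P [set w | (l * (8 * L / p) <= `|W t w - W u w|)%R])%E.
  apply: le_measure; rewrite ?inE.
  - by apply: measurable_norm_le; apply: measurable_funD => //; exact: measurable_funB.
  - by apply: measurable_norm_ge; exact: measurable_funB.
  move=> w /= h.
  have := ler_normB (W t w - W u w + m) (W t w - W u w).
  rewrite (_ : W t w - W u w + m - (W t w - W u w) = m); last by ring.
  move=> h2.
  have : (1 + l * 8 / p) * L = L + l * (8 * L / p) by field; rewrite gt_eqF.
  move: mL; rewrite -/l; lra.
move=> /(le_trans pP)/le_trans/(_ tail); rewrite lee_fin.
by rewrite leNgt Plt.
Qed.

Lemma nonnegligible_admissible (t0 q sigma : R) :
  ~ P.-negligible [set w | admissible (X ^~ w) t0 q sigma] ->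
  admissible phi t0 (2 * q) (2 * sigma) /\ admissible psi t0 q sigma.
Proof.
move=> nA.
have [N nN] : exists N, ~ P.-negligible
    [set w | increment_bounded (X ^~ w) t0 q sigma N].
  apply: contrapT => H; apply: nA.
  have -> : [set w | admissible (X ^~ w) t0 q sigma] =
      \bigcup_N [set w | increment_bounded (X ^~ w) t0 q sigma N].
    by apply/seteqP; split=> [w [N HN]|w [N _ HN]]; exists N.
  apply: negligible_bigcup => N; apply: contrapT => HN; apply: H; by exists N.
pose L (rho t u : R) : R := N.+1%:R * (`|t - u| `^ sigma * rho `^ (- q)).
pose valid (rho t u : R) := [/\ 0 < rho, rho < N.+1%:R^-1, ball_half_line t0 rho t,
  ball_half_line t0 rho u & t <> u].
pose M (rho t u : R) : set T :=
  [set w | `|W t w - W u w + (psi t - psi u)| <= L rho t u].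
have pos (rho t : R) : ball_half_line t0 rho t -> 0 <= t.
  by move=> [_]; rewrite half_lineE /= in_itv/= andbT.
(* With [N] fixed, the non-negligible set lies in every [M rho t u], so [p] does not depend on rho,
   t, u. *)
have [p p0 pM] : exists2 p : R, 0 < p &
    forall rho t u, valid rho t u -> (p%:E <= P (M rho t u))%E.
  have [] := @nonnegligible_lower_bound _ _ _ P _
    [set Z | exists rho t u, valid rho t u /\ Z = M rho t u] nN.
    move=> _ [rho [t [u [[rho0 rhoN bt bu tu] ->]]]]; split.
      apply: measurable_norm_le; apply: measurable_funD => //.
      exact: measurable_funB.
    move=> w H; have := H rho t u rho0 rhoN bt bu tu.
    rewrite (hX (pos _ _ bt)) (hX (pos _ _ bu)) /M /=.
    by rewrite (_ : _ + _ - _ = W t w - W u w + (psi t - psi u)); [|ring].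
  move=> p p0 Hp; exists p => // rho t u vtu.
  by apply: Hp; exists rho, t, u.
have L0 rho t u : valid rho t u -> 0 < L rho t u.
  move=> [rho0 _ _ _ tu]; rewrite !mulr_gt0 ?powR_gt0//.
  by rewrite normr_gt0 subr_eq0; apply/eqP.
have bounds rho t u : valid rho t u ->
    `|phi t - phi u| <= (8 * L rho t u / p) ^+ 2 /\
    `|psi t - psi u| <= (1 + Num.sqrt (128 / p) * 8 / p) * L rho t u.
  wlog ut : t u / u <= t.
    move=> H vtu; have [ut|/ltW tu] := leP u t; first exact: H.
    rewrite distrC (distrC (psi t)) /L (distrC t u); apply: H => //.
    by case: vtu => *; split => //; exact/nesym.
  move=> vtu; have [_ _ bt bu _] := vtu.
  have [h1 h2] :=
    likely_increment_bounds (pos _ _ bu) ut (L0 _ _ _ vtu) p0 (pM _ _ _ vtu).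
  by rewrite ger0_norm// subr_ge0 (sqr_integral_homo heta)// (pos _ _ bu).
have N0 : 0 < N.+1%:R^-1 :> R by rewrite invr_gt0.
split.
(* A variance is bounded by the square of [L]: squaring doubles both exponents. *)
- apply: (@admissible_ex _ _ _ _ _ _ ((8 / p) ^+ 2 * N.+1%:R ^+ 2) N0).
  move=> rho t u rho0 rhoN bt bu tu.
  have vtu : valid rho t u by split.
  apply: (le_trans (bounds _ _ _ vtu).1).
  have sqE (x a : R) : 0 < x -> x `^ (2 * a) = (x `^ a) ^+ 2.
    by move=> x0; rewrite mulrC powRrM powR_mulrn ?powR_ge0.
  have tu0 : 0 < `|t - u| by rewrite normr_gt0 subr_eq0; apply/eqP.
  rewrite -mulrN (sqE `|t - u|)// (sqE rho)// /L.
  rewrite le_eqVlt; apply/orP; left; apply/eqP; field; by rewrite gt_eqF.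
- apply: (@admissible_ex _ _ _ _ _ _
    ((1 + Num.sqrt (128 / p) * 8 / p) * N.+1%:R) N0).
  move=> rho t u rho0 rhoN bt bu tu.
  have vtu : valid rho t u by split.
  by rewrite -[leRHS]mulrA; exact: (bounds _ _ _ vtu).2.
Qed.

End upper_bound.

(** * Chaining along dyadic numbers *)

Section dyadic_chaining.
Context {R : realType}.
Implicit Types (x y z M A rho : R) (n m : nat).

Definition dyadic_floor n y : R := (Num.truncn (2 ^+ n * y))%:R / 2 ^+ n.

Lemma dyadic_floor_itv n y : 0 <= y ->
  dyadic_floor n y <= y < dyadic_floor n y + (2 ^+ n)^-1.
Proof.
move=> y0; have y20 : 0 <= 2 ^+ n * y by rewrite mulr_ge0// exprn_ge0.
have /andP[h1 h2] := truncn_itv y20.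
rewrite /dyadic_floor ler_pdivrMr// (mulrC y) h1/=.
by rewrite -[X in _ < _ + X]mul1r -mulrDl ltr_pdivlMr// natr1 (mulrC y).
Qed.

Lemma dyadic_floor_ge0 n y : 0 <= dyadic_floor n y.
Proof. by rewrite /dyadic_floor divr_ge0// exprn_ge0. Qed.

(** Passing to the next level crosses at most one step of the finer grid, so each link of the chain
    is a single dyadic increment. *)
Lemma dyadic_floorS n y : 0 <= y ->
  dyadic_floor n.+1 y = dyadic_floor n y \/
  exists j : nat, dyadic_floor n y = j%:R / 2 ^+ n.+1 /\
    dyadic_floor n.+1 y = j.+1%:R / 2 ^+ n.+1.
Proof.
move=> y0; have y20 : 0 <= 2 ^+ n * y by rewrite mulr_ge0// exprn_ge0.
have /andP[] := truncn_itv y20; rewrite /dyadic_floor.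
set k := Num.truncn _ => h1 h2.
have kE : k%:R / 2 ^+ n = (2 * k)%:R / 2 ^+ n.+1 :> R.
  by rewrite exprS natrM; field; rewrite gt_eqF.
rewrite kE.
have y2S : 2 ^+ n.+1 * y = 2 * (2 ^+ n * y) by rewrite exprS mulrA.
have [h|h] := ltP (2 ^+ n.+1 * y) (2 * k).+1%:R.
  left; congr (_%:R / _); apply: truncn_def; rewrite h andbT y2S natrM.
  by rewrite ler_wpM2l.
right; exists (2 * k)%N; split => //; congr (_%:R / _).
apply: truncn_def; rewrite h/= y2S.
have -> : (2 * k).+2%:R = 2 * k.+1%:R :> R.
  by rewrite -natrM mulnS addnC addn2.
by rewrite ltr_pM2l.
Qed.

Lemma dyadic_floor_close n y y' : 0 <= y -> y <= y' -> y' - y < (2 ^+ n)^-1 ->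
  dyadic_floor n y' = dyadic_floor n y \/
  exists j : nat, dyadic_floor n y = j%:R / 2 ^+ n /\
    dyadic_floor n y' = j.+1%:R / 2 ^+ n.
Proof.
move=> y0 yy' yn; have y'0 := le_trans y0 yy'.
have y20 : 0 <= 2 ^+ n * y by rewrite mulr_ge0// exprn_ge0.
have /andP[] := truncn_itv y20; rewrite /dyadic_floor.
set k := Num.truncn (2 ^+ n * y) => h1 h2.
have h3 : 2 ^+ n * y' < 2 ^+ n * y + 1.
  by rewrite -ltrBlDl -mulrBr -ltr_pdivlMl// mulr1.
have h4 : 2 ^+ n * y <= 2 ^+ n * y' by rewrite ler_pM2l.
have [h|h] := ltP (2 ^+ n * y') k.+1%:R.
  left; congr (_%:R / _); apply: truncn_def; rewrite h andbT.
  exact: le_trans h1 h4.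
right; exists k; split => //; congr (_%:R / _); apply: truncn_def.
rewrite h/=; apply: (lt_trans h3).
by rewrite -[k.+2%:R]natr1 ltrD2r.
Qed.

Section chain.
Variables (z : R -> R) (M A rho : R) (n0 : nat).
Hypotheses (A0 : 0 <= A) (rho0 : 0 < rho) (rho1 : rho < 1).
Hypothesis zstep : forall n (j : nat), (n0 <= n)%N ->
  j.+1%:R / 2 ^+ n <= M ->
  `|z (j.+1%:R / 2 ^+ n) - z (j%:R / 2 ^+ n)| <= A * rho ^+ n.

Lemma dyadic_chain y n m : 0 <= y -> y <= M -> (n0 <= n)%N ->
  `|z (dyadic_floor (n + m) y) - z (dyadic_floor n y)| <=
  A / (1 - rho) * rho ^+ n.
Proof.
move=> y0 yM nn0.
have rho10 : 0 < 1 - rho by rewrite subr_gt0.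
(* The geometric sum is kept in closed form for the induction: the coefficient times rho^k - rho^(k
   + 1) is exactly A rho^k. *)
suff H : `|z (dyadic_floor (n + m) y) - z (dyadic_floor n y)| <=
    A / (1 - rho) * (rho ^+ n - rho ^+ (n + m)).
  apply: (le_trans H); rewrite ler_wpM2l ?divr_ge0 ?(ltW rho10)//.
  by rewrite gerBl exprn_ge0// ltW.
elim: m => [|m IH]; first by rewrite addn0 !subrr normr0 mulr0.
rewrite addnS.
have step : `|z (dyadic_floor (n + m).+1 y) - z (dyadic_floor (n + m) y)| <=
    A * rho ^+ (n + m).
  have H : A * rho ^+ (n + m).+1 <= A * rho ^+ (n + m).
    by rewrite ler_wpM2l// exprS ler_piMl ?exprn_ge0 ?(ltW rho0) ?(ltW rho1).
  have [->|[j [jE jSE]]] := dyadic_floorS (n + m) y0.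
    by rewrite subrr normr0 mulr_ge0 ?exprn_ge0 ?(ltW rho0).
  apply: le_trans H; rewrite jE jSE; apply: zstep.
    by rewrite (leq_trans nn0)// -addnS leq_addr.
  rewrite -jSE; apply: le_trans yM.
  by have /andP[] := dyadic_floor_itv (n + m).+1 y0.
rewrite (_ : z (dyadic_floor (n + m).+1 y) - z (dyadic_floor n y) =
  (z (dyadic_floor (n + m).+1 y) - z (dyadic_floor (n + m) y)) +
  (z (dyadic_floor (n + m) y) - z (dyadic_floor n y))); last by ring.
apply: (le_trans (ler_normD _ _)); apply: (le_trans (lerD step IH)).
rewrite le_eqVlt; apply/orP; left; apply/eqP.
by rewrite exprS; field; rewrite gt_eqF.
Qed.

Lemma dyadic_chain_limit y n l : 0 <= y -> y <= M -> (n0 <= n)%N ->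
  z (dyadic_floor m y) @[m --> \oo] --> l ->
  `|l - z (dyadic_floor n y)| <= A / (1 - rho) * rho ^+ n.
Proof.
move=> y0 yM nn0 zl; apply/ler_addgt0Pr => e e0.
near \oo => m.
have h1 : `|l - z (dyadic_floor m y)| <= e.
  by near: m; move/cvgrPdist_le : zl; exact.
have nm : (n <= m)%N by near: m; exact: nbhs_infty_ge.
have h2 := dyadic_chain (m - n) y0 yM nn0; rewrite subnKC// in h2.
rewrite (_ : l - z (dyadic_floor n y) = (l - z (dyadic_floor m y)) +
  (z (dyadic_floor m y) - z (dyadic_floor n y))); last by ring.
by apply: (le_trans (ler_normD _ _)); rewrite addrC lerD.
Unshelve. all: by end_near. Qed.

(** Two chains, from [y] and from [y'] to their floors at level [n], are joined by at most one step,
    whence 1 + 2 / (1 - rho). *)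
Lemma dyadic_modulus y y' n l l' : 0 <= y -> y <= M -> 0 <= y' -> y' <= M ->
  (n0 <= n)%N -> `|y - y'| < (2 ^+ n)^-1 ->
  z (dyadic_floor m y) @[m --> \oo] --> l ->
  z (dyadic_floor m y') @[m --> \oo] --> l' ->
  `|l - l'| <= A * (1 + 2 / (1 - rho)) * rho ^+ n.
Proof.
move=> y0 yM y'0 y'M nn0; wlog yy' : y y' l l' y0 yM y'0 y'M / y' <= y.
  move=> H yn zl zl'; have [h|/ltW h] := leP y' y; first exact: (H y y').
  by rewrite distrC; apply: (H y' y) => //; rewrite distrC.
move=> yn zl zl'.
have h1 := dyadic_chain_limit y0 yM nn0 zl.
have h2 := dyadic_chain_limit y'0 y'M nn0 zl'.
have h3 : `|z (dyadic_floor n y) - z (dyadic_floor n y')| <= A * rho ^+ n.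
  rewrite ger0_norm ?subr_ge0// in yn.
  have [->|[j [jE jSE]]] := dyadic_floor_close y'0 yy' yn.
    by rewrite subrr normr0 mulr_ge0 ?exprn_ge0 ?(ltW rho0).
  rewrite jE jSE; apply: zstep => //; rewrite -jSE; apply: le_trans yM.
  by have /andP[] := dyadic_floor_itv n y0.
rewrite (_ : l - l' = (l - z (dyadic_floor n y)) +
  (z (dyadic_floor n y) - z (dyadic_floor n y')) - (l' - z (dyadic_floor n y')));
  last by ring.
apply: (le_trans (ler_normB _ _)).
apply: (le_trans (lerD (ler_normD _ _) (lexx _))).
apply: (le_trans (lerD (lerD h1 h3) h2)).
rewrite le_eqVlt; apply/orP; left; apply/eqP; field.
by rewrite subr_eq0 gt_eqF.
Qed.

End chain.
End dyadic_chaining.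

(** * Modulus of continuity of a path relative to its clock *)

Section path_modulus.
Context {R : realType}.
Implicit Types (f x z phi : R -> R) (K e : R).

Lemma within_continuous_dist K f t e : 0 < K -> 0 < e ->
  {within `[0, K], continuous f} -> 0 <= t -> t <= K ->
  exists2 delta, 0 < delta &
    forall s, 0 <= s -> s <= K -> `|s - t| < delta -> `|f t - f s| < e.
Proof.
move=> K0 e0 /subspace_continuousP cf t0 tK.
have := cf t; rewrite /= in_itv/= t0 tK => /(_ isT) /cvgrPdist_lt/(_ e e0).
move=> /nbhs_ballP[delta /= delta0 H]; exists delta => // s s0 sK st.
by apply: H; rewrite /ball/= ?in_itv/= ?s0// distrC.
Qed.

Lemma rational_near K t delta : 0 < K -> 0 < delta -> 0 <= t -> t <= K ->
  exists q : rat, [/\ 0 <= ratr q :> R, ratr q <= K & `|ratr q - t| < delta].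
Proof.
move=> K0 delta0 t0 tK.
have h : Num.max 0 (t - delta) < Num.min K (t + delta).
  rewrite gt_max !lt_min; apply/andP; split; apply/andP; split; lra.
have [q] := rat_in_itvoo h;
rewrite in_itv/= gt_max lt_min => /andP[/andP[q1 q2] /andP[q3 q4]].
exists q; split; [exact: ltW|exact: ltW|].
by rewrite ltr_norml; apply/andP; split; lra.
Qed.

(** From Bernoulli's inequality. It absorbs the factor n + 1 of the increment bounds into a ratio
    slightly above 1. *)
Lemma linear_le_geometric (k : R) n : 1 < k ->
  n.+1%:R <= (1 + (k - 1)^-1) * k ^+ n.
Proof.
move=> k1; have k10 : 0 < k - 1 by rewrite subr_gt0.
have kV0 : 0 < (k - 1)^-1 by rewrite invr_gt0.
have Bernoulli : 1 + n%:R * (k - 1) <= k ^+ n.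
  elim: n => [|n IH]; first by rewrite mul0r addr0 expr0.
  rewrite exprS; apply: (@le_trans _ _ (k * (1 + n%:R * (k - 1)))).
    have : 0 <= n%:R * (k - 1) * (k - 1) by rewrite !mulr_ge0// ltW.
    by rewrite -natr1; nra.
  by rewrite ler_pM2l//; lra.
have c0 : 0 <= 1 + (k - 1)^-1 by lra.
apply: (le_trans _ (ler_wpM2l c0 Bernoulli)).
have -> : (1 + (k - 1)^-1) * (1 + n%:R * (k - 1)) =
    n%:R + 1 + (k - 1)^-1 + n%:R * (k - 1).
  by field; rewrite gt_eqF.
rewrite -natr1.
have : 0 <= n%:R * (k - 1) by rewrite mulr_ge0// ltW.
lra.
Qed.

Lemma path_modulus K D phi x z : 0 < K -> 0 <= D ->
  {within `[0, K], continuous phi} -> {within `[0, K], continuous x} ->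
  (forall t, 0 <= t -> t <= K -> 0 <= phi t /\ phi t <= phi K) ->
  (exists n0, forall n j, (n0 <= n)%N -> j.+1%:R / 2 ^+ n <= phi K ->
    `|z (j.+1%:R / 2 ^+ n) - z (j%:R / 2 ^+ n)| <=
    D * n.+1%:R * (Num.sqrt 2)^-1 ^+ n) ->
  (forall q : rat, 0 <= ratr q :> R -> ratr q <= K ->
    z (dyadic_floor m (phi (ratr q))) @[m --> \oo] --> x (ratr q)) ->
  forall a, 0 < a -> a < 2^-1 -> exists C delta, [/\ 0 <= C, 0 < delta &
    forall t u, 0 <= t -> t <= K -> 0 <= u -> u <= K ->
      `|phi t - phi u| < delta -> `|x t - x u| <= C * `|phi t - phi u| `^ a].
Proof.
move=> K0 D0 cphi cx phiM [n0 zstep] zq a a0 a2.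
pose rho : R := 2 `^ (- a).
have rho0 : 0 < rho by rewrite powR_gt0.
have rhoV : rho^-1 = 2 `^ a by rewrite /rho powRN invrK.
have pow_gt1 (b : R) : 0 < b -> 1 < 2 `^ b.
  move=> b0; rewrite /powR pnatr_eq0/= expR_gt1 mulr_gt0// ln_gt0//.
  by rewrite ltr1n.
have rho1 : rho < 1 by rewrite -invf_gt1// rhoV pow_gt1.
have sqrt2E : Num.sqrt 2 = 2 `^ 2^-1 :> R by rewrite -powR12_sqrt.
(* Here k > 1 because a < 1/2, which leaves room to bound (n + 1) sqrt(2)^(- n) by a constant times
   rho^n. *)
pose k : R := 2 `^ (2^-1 - a).
have k1 : 1 < k by apply: pow_gt1; rewrite subr_gt0.
have kE : k = rho * Num.sqrt 2.
  by rewrite sqrt2E /rho -powRD ?pnatr_eq0 ?implybT// addrC.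
have sqrt20 : 0 < Num.sqrt 2 :> R by rewrite sqrtr_gt0.
pose A := D * (1 + (k - 1)^-1).
have A0 : 0 <= A by rewrite mulr_ge0// addr_ge0// invr_ge0 subr_ge0 ltW.
have {}zstep n j : (n0 <= n)%N -> j.+1%:R / 2 ^+ n <= phi K ->
    `|z (j.+1%:R / 2 ^+ n) - z (j%:R / 2 ^+ n)| <= A * rho ^+ n.
  move=> nn0 jM; apply: (le_trans (zstep n j nn0 jM)).
  rewrite /A -!mulrA ler_wpM2l// exprVn ler_pdivrMr ?exprn_gt0//.
  by rewrite -!mulrA -exprMn -kE linear_le_geometric.
pose C := A * (1 + 2 / (1 - rho)).
have C0 : 0 <= C by rewrite mulr_ge0// addr_ge0// divr_ge0// subr_ge0 ltW.
have main t u n : 0 <= t -> t <= K -> 0 <= u -> u <= K -> (n0 <= n)%N ->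
    `|phi t - phi u| < (2 ^+ n)^-1 -> `|x t - x u| <= C * rho ^+ n.
  move=> t0 tK u0 uK nn0 tun; apply/ler_addgt0Pr => e e0.
  (* Half the gap in the strict inequality: replacing both times by rational ones moves the clock
     difference by less than the gap. *)
  pose eta := ((2 ^+ n)^-1 - `|phi t - phi u|) / 2.
  have eta0 : 0 < eta by rewrite divr_gt0// subr_gt0.
  have e20 : 0 < e / 2 by lra.
  have approx s : 0 <= s -> s <= K -> exists q : rat, [/\ 0 <= ratr q :> R,
      ratr q <= K, `|phi s - phi (ratr q)| < eta & `|x s - x (ratr q)| < e / 2].
    move=> s0 sK.
    have [d1 d10 H1] := within_continuous_dist K0 eta0 cphi s0 sK.
    have [d2 d20 H2] := within_continuous_dist K0 e20 cx s0 sK.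
    have d0 : 0 < Num.min d1 d2 by rewrite lt_min d10.
    have [q [q0 qK]] := rational_near K0 d0 s0 sK.
    rewrite lt_min => /andP[qd1 qd2].
    by exists q; split => //; [exact: H1|exact: H2].
  have [p [p0 pK pphi px]] := approx t t0 tK.
  have [q [q0 qK qphi qx]] := approx u u0 uK.
  have pqn : `|phi (ratr p) - phi (ratr q)| < (2 ^+ n)^-1.
    rewrite (_ : phi (ratr p) - phi (ratr q) = (phi t - phi u) -
      (phi t - phi (ratr p)) + (phi u - phi (ratr q))); last by ring.
    apply: (le_lt_trans (ler_normD _ _)).
    apply: (le_lt_trans (lerD (ler_normB _ _) (lexx _))).
    by move: pphi qphi; rewrite /eta; lra.
  have [M0 MK] := phiM _ p0 pK; have [M0' MK'] := phiM _ q0 qK.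
  have := dyadic_modulus A0 rho0 rho1 zstep M0 MK M0' MK' nn0 pqn
    (zq _ p0 pK) (zq _ q0 qK).
  rewrite -/C => h.
  rewrite (_ : x t - x u = (x (ratr p) - x (ratr q)) +
    (x t - x (ratr p)) - (x u - x (ratr q))); last by ring.
  apply: (le_trans (ler_normB _ _)).
  apply: (le_trans (lerD (ler_normD _ _) (lexx _))).
  by lra.
exists (C * 2 `^ a), (2 ^+ n0)^-1; split => //.
  by rewrite mulr_ge0// powR_ge0.
move=> t u t0 tK u0 uK tu.
have pow_small (h : R) : 0 < h -> exists n : nat, (2 ^+ n)^-1 <= h.
  move=> h0; exists (Num.bound h^-1); rewrite invf_ple ?posrE ?exprn_gt0//.
  have hb : h^-1 < (Num.bound h^-1)%:R by apply: archi_boundP; rewrite invr_ge0 ltW.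
  apply: ltW; apply: (lt_le_trans hb); rewrite -natrX ler_nat.
  exact: ltnW (ltn_expl _ _).
(* With equal clock values every scale is available, and the bound tends to 0. *)
have [h0|h0] := eqVneq `|phi t - phi u| 0.
  rewrite h0 powR0 ?gt_eqF// mulr0.
  apply/ler_addgt0Pr => e e0; rewrite add0r.
  have /cvgrPdist_lt/(_ e e0) : C * rho ^+ n @[n --> \oo] --> (0 : R).
    by apply: (@cvg_geometric R C rho); rewrite gtr0_norm.
  move=> [n1 _ Hn1]; have := Hn1 (maxn n0 n1) (leq_maxr _ _).
  have Cr0 : 0 <= C * rho ^+ maxn n0 n1 by rewrite mulr_ge0// exprn_ge0// ltW.
  rewrite /= sub0r normrN (ger0_norm Cr0) => h.
  apply: (le_trans _ (ltW h)); apply: main; rewrite ?leq_maxl//.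
  by rewrite h0 invr_gt0 exprn_gt0.
have {}h0 : 0 < `|phi t - phi u| by rewrite lt_neqAle eq_sym h0 normr_ge0.
(* By minimality the clock difference lies between 2^(- m) and 2^(- m + 1). Using the coarser scale
   costs the factor 2^a in the constant; [delta] was chosen so that this scale is still at least
   [n0]. *)
have [m mle mmin] := ex_minnP (pow_small _ h0).
have n0m : (n0 < m)%N.
  rewrite ltnNge; apply/negP => mn0.
  have : (2 ^+ n0)^-1 <= (2 ^+ m)^-1 :> R.
    by rewrite lef_pV2 ?posrE ?exprn_gt0// ler_weXn2l// ler1n.
  by move=> /le_trans/(_ mle); rewrite leNgt tu.
case: m n0m mle mmin => // m n0m mle mmin.
have mlt : `|phi t - phi u| < (2 ^+ m)^-1.
  by rewrite ltNge; apply/negP => /mmin; rewrite ltnn.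
apply: (le_trans (main t u m t0 tK u0 uK n0m mlt)).
rewrite -[leRHS]mulrA; apply: ler_wpM2l => //.
have -> : rho ^+ m = 2 `^ a * ((2 ^+ m.+1)^-1) `^ a.
  have -> : (2 ^+ m.+1)^-1 = 2 `^ (- m.+1%:R) :> R by rewrite powRN powR_mulrn.
  rewrite -powRrM -powRD; last by apply/implyP; rewrite pnatr_eq0.
  rewrite -(powR_mulrn _ (ltW rho0)) /rho -powRrM.
  by congr (_ `^ _); rewrite -natr1; ring.
rewrite ler_wpM2l ?powR_ge0//.
by apply: ge0_ler_powR; rewrite ?nnegrE ?(ltW a0).
Qed.

End path_modulus.

(** * Countable families of almost sure events *)

Section almost_sure_events.
Context {R : realType} {d : measure_display} {T : measurableType d}.
Variable P : probability T R.

Lemma borel_cantelli_half (E : nat -> set T) (c : R) :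
  (forall n, measurable (E n)) -> (forall n, (P (E n) <= (c / 2 ^+ n)%:E)%E) ->
  {ae P, forall w, exists n0, forall n, (n0 <= n)%N -> ~ E n w}.
Proof.
move=> mE PE.
have null : P (lim_sup_set E) = 0%E.
  apply: lim_sup_set_cvg0 => //.
  apply: (@le_lt_trans _ _ (\sum_(0 <= n <oo) (2 * c / (2 ^ (n + 1))%:R)%:E)%E).
    apply: lee_nneseries => // n _; apply: (le_trans (PE n)).
    rewrite lee_fin natrX exprD expr1 le_eqVlt; apply/orP; left; apply/eqP.
    by field; rewrite gt_eqF// exprn_gt0.
  have /cvg_lim -> // := @cvg_geometric_eseries_half R (2 * c) 0.
  exact: ltry.
exists (lim_sup_set E); split => //.
  apply: bigcapT_measurable => n; apply: bigcup_measurable => k _; exact: mE.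
move=> w /= H; apply: contrapT => Hw; apply: H; apply: contrapT => H.
apply: Hw => n _; apply: contrapT => Hn; apply: H; exists n => k nk Ek.
by apply: Hn; exists k.
Qed.

Lemma ae_forall_countType (I : countType) (Q : I -> T -> Prop) :
  (forall i, {ae P, forall w, Q i w}) -> {ae P, forall w, forall i, Q i w}.
Proof.
move=> H.
have : {ae P, forall w, forall n : nat,
    if @unpickle I n is Some i then Q i w else True}.
  apply: ae_foralln => n; case: (unpickle n) => [i|]; first exact: H.
  exact: aeW.
by apply: filterS => w Hw i; have := Hw (pickle i); rewrite pickleK.
Qed.

End almost_sure_events.

(** * Hoelder regularity of the Wiener integral relative to its clock *)

Section wiener_modulus.
Context {R : realType} {d : measure_display} {T : measurableType d}.
Variable P : probability T R.
Variables (B W : R -> {RV P >-> R}) (eta : R -> R).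
Hypothesis hB : brownian_motion B.
Hypothesis heta : eta \_ (@nonneg_half_line R) \in Lfun (@lebesgue_measure R) 2%:E.
Hypothesis hW : forall t, 0 <= t -> wiener_integral_of B (eta \_ `[0, t]) (W t).
Local Notation phi := (sqr_integral eta).

(** At level n the standard deviation is at most 2^(- n / 2). The factor 16 (n + 1) makes the tail
    exponent 4 (n + 1)^2, so the probability 2 / 4^n remains summable after a union over about 2^n
    increments. *)
Let threshold n : R := 16 * n.+1%:R * (Num.sqrt 2)^-1 ^+ n.

Let sqrt2_gt0 : 0 < Num.sqrt 2 :> R. Proof. by rewrite sqrtr_gt0. Qed.

Let threshold_gt0 n : 0 < threshold n.
Proof. by rewrite /threshold !mulr_gt0// exprn_gt0// invr_gt0. Qed.

Let measurable_increment t u x : measurable [set w | x <= `|W t w - W u w|].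
Proof. by apply: measurable_norm_ge; exact: measurable_funB. Qed.

Lemma dyadic_increment_tail u t n : 0 <= u -> 0 <= t ->
  `|phi t - phi u| <= (2 ^+ n)^-1 ->
  (P [set w | (threshold n <= `|W t w - W u w|)%R] <= (2 / 4 ^+ n)%:E)%E.
Proof.
wlog ut : u t / u <= t.
  move=> H u0 t0 h; have [ut|/ltW tu] := leP u t; first exact: H.
  under eq_set do rewrite distrC.
  by apply: H => //; rewrite distrC.
move=> u0 t0; rewrite ger0_norm ?subr_ge0 ?(sqr_integral_homo heta)// => h.
pose s : R := (Num.sqrt 2)^-1 ^+ n.
have s0 : 0 < s by rewrite exprn_gt0// invr_gt0.
have s2 : s ^+ 2 = (2 ^+ n)^-1.
  by rewrite /s exprVn exprVn -exprM mulnC exprM sqr_sqrtr.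
rewrite -s2 in h.
apply: (le_trans (wiener_increment_tail hB heta hW u0 ut h s0 (threshold_gt0 n))).
rewrite lee_fin ler_wpM2l//.
have -> : threshold n ^+ 2 / (64 * s ^+ 2) = 4 * n.+1%:R ^+ 2.
  by rewrite /threshold -/s; field; rewrite gt_eqF.
rewrite expRN lef_pV2 ?posrE ?expR_gt0 ?exprn_gt0//.
apply: (@le_trans _ _ (expR (n.+1%:R * 4))).
  rewrite expRM_natl; apply: (@le_trans _ _ (4 ^+ n.+1)).
    by rewrite ler_weXn2l// ler1n.
  rewrite lerXn2r ?nnegrE ?expR_ge0//.
  by apply: le_trans (expR_ge1Dx _); lra.
rewrite ler_expR mulrC ler_wpM2l// expr2 ler_peMr//.
by rewrite ler1n.
Qed.

Variable K : R.
Hypothesis K0 : 0 < K.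

(** A choice of preimage under the clock, which need not be injective. The default 0 is not reached
    for y in [0, phi K], by the intermediate value theorem. *)
Definition energy_time (y : R) : R :=
  xget 0 [set t | [/\ 0 <= t, t <= K & phi t = y]].

Lemma energy_timeP y : 0 <= y -> y <= phi K ->
  [/\ 0 <= energy_time y, energy_time y <= K & phi (energy_time y) = y].
Proof.
move=> y0 yK; rewrite /energy_time; case: xgetP => [t -> []//|none].
have := @IVT _ phi 0 K y (ltW K0) (sqr_integral_continuous heta (ltW K0)).
rewrite sqr_integral0 (min_idPl _) ?(max_idPr _) ?sqr_integral_ge0//.
rewrite y0 yK => /(_ isT)[c]; rewrite in_itv/= => /andP[c0 cK] cy.
by exfalso; apply: (none c).
Qed.

Lemma ae_dyadic_increments :
  {ae P, forall w, exists n0, forall n j, (n0 <= n)%N ->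
  j.+1%:R / 2 ^+ n <= phi K ->
  `|W (energy_time (j.+1%:R / 2 ^+ n)) w - W (energy_time (j%:R / 2 ^+ n)) w|
  <= threshold n}.
Proof.
pose J n := Num.truncn (2 ^+ n * phi K).
pose E n j : set T := [set w | threshold n <=
  `|W (energy_time (j.+1%:R / 2 ^+ n)) w - W (energy_time (j%:R / 2 ^+ n)) w|].
pose F n := \big[setU/set0]_(j < J n) E n j.
have pK n : 0 <= 2 ^+ n * phi K by rewrite mulr_ge0 ?exprn_ge0 ?sqr_integral_ge0.
have JP n j : (j < J n)%N = (j.+1%:R / 2 ^+ n <= phi K).
  by rewrite /J truncn_ge_nat// ler_pdivrMr ?exprn_gt0// mulrC.
have mE n j : measurable (E n j) by exact: measurable_increment.
have mF n : measurable (F n) by apply: bigsetU_measurable.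
have PE n j : (j < J n)%N -> (P (E n j) <= (2 / 4 ^+ n)%:E)%E.
  rewrite JP => jK.
  have jj : j%:R / 2 ^+ n <= j.+1%:R / 2 ^+ n :> R.
    by rewrite ler_wpM2r ?invr_ge0 ?exprn_ge0// ler_nat.
  have j_ge0 (i : nat) : 0 <= i%:R / 2 ^+ n :> R by rewrite divr_ge0// exprn_ge0.
  have [h1 h2 h3] := energy_timeP (j_ge0 _) jK.
  have [h4 h5 h6] := energy_timeP (j_ge0 _) (le_trans jj jK).
  apply: dyadic_increment_tail => //.
  rewrite h3 h6 -mulrBl -natr1 addrAC subrr add0r mul1r ger0_norm//.
(* At most 2^n phi(K) events of probability at most 2 / 4^n each. *)
have PF n : (P (F n) <= (2 * phi K / 2 ^+ n)%:E)%E.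
  apply: (le_trans (Boole_inequality P (fun j _ => mE n j))).
  apply: (@le_trans _ _ (\sum_(j < J n) (2 / 4 ^+ n)%:E)%E).
    by apply: lee_sum => j _; exact: PE.
  rewrite sumEFin sumr_const card_ord lee_fin -[X in X <= _]mulr_natl.
  have JK : (J n)%:R <= 2 ^+ n * phi K by rewrite truncn_le.
  apply: (@le_trans _ _ (2 ^+ n * phi K * (2 / 4 ^+ n))).
    by rewrite ler_wpM2r// divr_ge0// exprn_ge0.
  have -> : 4 ^+ n = 2 ^+ n * 2 ^+ n :> R.
    by rewrite -exprMn; congr (_ ^+ _); ring.
  rewrite le_eqVlt; apply/orP; left; apply/eqP; field.
  by rewrite gt_eqF// exprn_gt0.
have := borel_cantelli_half mF PF.
apply: filterS => w [n0 H]; exists n0 => n j nn0 jK.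
rewrite leNgt; apply/negP => h; apply: (H n nn0).
rewrite /F -bigcup_mkord; exists j; first by rewrite /= JP.
exact: ltW.
Qed.

(** The sampled times have clock values within 2^(- m) of that of [t], so the increments to [W t]
    pass below the threshold by Borel-Cantelli, even where the clock is flat. *)
Lemma ae_dyadic_limit (t : R) : 0 <= t -> t <= K ->
  {ae P, forall w,
    W (energy_time (dyadic_floor m (phi t))) w @[m --> \oo] --> W t w}.
Proof.
move=> t0 tK.
have phi_t0 : 0 <= phi t := sqr_integral_ge0 eta t.
have phi_tK : phi t <= phi K by exact: (sqr_integral_homo heta).
pose E m : set T := [set w | threshold m <=
  `|W t w - W (energy_time (dyadic_floor m (phi t))) w|].
have mE m : measurable (E m) by exact: measurable_increment.
have PE m : (P (E m) <= (2 / 2 ^+ m)%:E)%E.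
  have /andP[f1 f2] := dyadic_floor_itv m phi_t0.
  have [h1 h2 h3] := energy_timeP (dyadic_floor_ge0 m _) (le_trans f1 phi_tK).
  apply: (@le_trans _ _ (2 / 4 ^+ m)%:E).
    apply: dyadic_increment_tail => //.
    by rewrite h3 ger0_norm ?subr_ge0//; lra.
  rewrite lee_fin ler_wpM2l// lef_pV2 ?posrE ?exprn_gt0//.
  by rewrite lerXn2r ?nnegrE//; lra.
have := borel_cantelli_half mE PE.
apply: filterS => w [n0 H].
(* The ratio 5/4 is a number in ]1, sqrt 2[: above 1 to absorb m + 1, below sqrt 2 to keep the
   product convergent to 0. *)
have lim0 : 16 * (1 + (5 / 4 - 1)^-1) * (5 / 4 * (Num.sqrt 2)^-1) ^+ n
    @[n --> \oo] --> (0 : R).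
  apply: cvg_geometric; rewrite ger0_norm ?divr_ge0//.
  rewrite ltr_pdivrMr// mul1r -[ltLHS]ger0_norm ?divr_ge0//.
  by rewrite -sqrtr_sqr ltr_sqrt//; lra.
apply/cvgrPdist_lt => e e0; near=> m.
have nm : (n0 <= m)%N by near: m; exact: nbhs_infty_ge.
have h1 : `|0 - 16 * (1 + (5 / 4 - 1)^-1) * (5 / 4 * (Num.sqrt 2)^-1) ^+ m| < e.
  by near: m; move/cvgrPdist_lt : lim0; exact.
have h2 : `|W t w - W (energy_time (dyadic_floor m (phi t))) w| < threshold m.
  by rewrite ltNge; apply/negP; exact: H.
apply: (lt_trans h2); apply: le_lt_trans h1.
rewrite sub0r normrN; apply: le_trans (ler_norm _).
rewrite /threshold exprMn mulrA ler_wpM2r ?exprn_ge0 ?invr_ge0 ?(ltW sqrt2_gt0)//.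
rewrite -mulrA ler_wpM2l//; apply: linear_le_geometric; lra.
Unshelve. all: by end_near. Qed.

(** The three almost sure facts combined here do not involve [a], so one null set serves all
    exponents. *)
Lemma wiener_modulus :
  {ae P, forall w, {within @nonneg_half_line R, continuous (W ^~ w)}} ->
  {ae P, forall w, forall a, 0 < a -> a < 2^-1 ->
    exists C delta, [/\ 0 <= C, 0 < delta &
      forall t u, 0 <= t -> t <= K -> 0 <= u -> u <= K ->
        `|phi t - phi u| < delta ->
        `|W t w - W u w| <= C * `|phi t - phi u| `^ a]}.
Proof.
move=> cW.
have lim_rat : {ae P, forall w, forall q : rat,
    0 <= ratr q :> R -> ratr q <= K ->
    W (energy_time (dyadic_floor m (phi (ratr q)))) w @[m --> \oo] --> W (ratr q) w}.
  apply: ae_forall_countType => q.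
  have [/andP[q0 qK]|nq] := boolP ((0 <= ratr q :> R) && (ratr q <= K)).
    by have := ae_dyadic_limit q0 qK; apply: filterS.
  by apply: aeW => w q0 qK; rewrite q0 qK in nq.
have := ae_dyadic_increments.
apply: filterS3 lim_rat cW => w Hq Hc Hinc.
apply: (@path_modulus _ K 16 phi (W ^~ w) (fun y => W (energy_time y) w)) => //.
- exact: (sqr_integral_continuous heta (ltW K0)).
- by apply: continuous_subspaceW Hc; exact: itv_sub_half_line.
- move=> t t0 tK; split; first exact: sqr_integral_ge0.
  exact: (sqr_integral_homo heta).
Qed.

End wiener_modulus.

(** * The frontier of the process *)

Section wiener_frontier.
Context {R : realType} {d : measure_display} {T : measurableType d}.
Variable P : probability T R.
Variables (B W : R -> {RV P >-> R}) (eta psi : R -> R) (X : R -> T -> R).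
Hypothesis hB : brownian_motion B.
Hypothesis heta : eta \_ (@nonneg_half_line R) \in Lfun (@lebesgue_measure R) 2%:E.
Hypothesis hW : forall t, 0 <= t -> wiener_integral_of B (eta \_ `[0, t]) (W t).
Hypothesis hX : forall t, 0 <= t -> forall w, X t w = W t w + psi t.
Variable t0 : R.
Hypothesis t0_ge0 : 0 <= t0.
Local Notation phi := (sqr_integral eta).

Lemma ae_admissible_bounds : {ae P, forall w, forall q sigma : rat,
  admissible (X ^~ w) t0 (ratr q) (ratr sigma) ->
  admissible phi t0 (2 * ratr q) (2 * ratr sigma) /\
  admissible psi t0 (ratr q) (ratr sigma)}.
Proof.
have : {ae P, forall w, forall z : rat * rat,
    admissible (X ^~ w) t0 (ratr z.1) (ratr z.2) ->
    admissible phi t0 (2 * ratr z.1) (2 * ratr z.2) /\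
    admissible psi t0 (ratr z.1) (ratr z.2)}.
  apply: ae_forall_countType => -[q sigma] /=.
  (* The conclusion is deterministic: either it holds outright, or admissibility for X at this
     rational pair is negligible. *)
  have [h|h] := pselect (admissible phi t0 (2 * ratr q) (2 * ratr sigma) /\
      admissible psi t0 (ratr q) (ratr sigma)); first exact: aeW.
  have nA : P.-negligible [set w | admissible (X ^~ w) t0 (ratr q) (ratr sigma)].
    apply: contrapT => nA; apply: h.
    exact: (nonnegligible_admissible hB heta hW hX nA).
  apply: negligibleS nA => w /= Hw; apply: contrapT => nw; apply: Hw => aw.
  by exfalso; exact: nw.
by apply: filterS => w H q sigma; exact: (H (q, sigma)).
Qed.

Lemma wiener_frontier :
  {ae P, forall w, {within @nonneg_half_line R, continuous (W ^~ w)}} ->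
  {ae P, forall w, forall s, s < 0 -> frontier (X ^~ w) t0 s =
    mine ((2^-1)%:E * frontier phi t0 (2 * s))%E (frontier psi t0 s)}.
Proof.
move=> cW.
have K0 : 0 < t0 + 1 by rewrite ltr_wpDl.
have := wiener_modulus hB heta hW K0 cW.
apply: filterS2 ae_admissible_bounds => w upper modulus s s0.
apply: (@frontier_min _ _ _ _ (W ^~ w)) => //.
- by move=> t tge0; exact: hX.
- move=> sigma b sb; apply: admissible_half_modulus => // a a0 a2.
  have [C [delta [C0 delta0 HC]]] := modulus a a0 a2.
  have d20 : 0 < delta / 2 by lra.
  have t0K : t0 <= t0 + 1 by rewrite lerDl.
  (* Continuity of the clock at [t0] puts both clock values within delta / 2 of that of [t0]. The
     bound 1 on the radius keeps the times in [0, t0 + 1]. *)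
  have [r r0 Hr] := within_continuous_dist K0 d20
    (sqr_integral_continuous heta (ltW K0)) t0_ge0 t0K.
  exists C, (Num.min r 1); split => //; first by rewrite lt_min r0 ltr01.
  have close t : ball_half_line t0 (Num.min r 1) t ->
      [/\ 0 <= t, t <= t0 + 1 & `|phi t0 - phi t| < delta / 2].
    move=> [bt]; rewrite half_lineE /= in_itv/= andbT => tge0.
    move: bt; rewrite /ball/= lt_min => /andP[tr t1].
    have tK : t <= t0 + 1 by move: t1; rewrite ltr_norml => /andP[h1 h2]; lra.
    by split => //; apply: Hr => //; rewrite distrC.
  move=> t u /close[tge0 tK tphi] /close[uge0 uK uphi]; apply: HC => //.
  rewrite (_ : phi t - phi u = (phi t0 - phi u) - (phi t0 - phi t)); last by ring.
  by apply: (le_lt_trans (ler_normB _ _)); lra.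
- by move=> q sigma _; exact: upper.
Qed.

End wiener_frontier.

Theorem theorem4p12 (R : realType) (d : measure_display)
    (T : measurableType d) (P : probability T R)
    (B : R -> {RV P >-> R}) (hB : brownian_motion B)
    (eta psi : R -> R)
    (heta : eta \_ (@nonneg_half_line R) \in Lfun (@lebesgue_measure R) 2%:E)
    (hpsi : psi \_ (@nonneg_half_line R) \in Lfun (@lebesgue_measure R) 2%:E)
    (W : R -> {RV P >-> R}) (hW : continuous_wiener_integral B eta W)
    (X : R -> T -> R)
    (hX : forall t, 0 <= t -> forall w, X t w = W t w + psi t)
    (t0 : R) (ht0 : 0 <= t0) :
  let phi : R -> R :=
    fun t => (\int[@lebesgue_measure R]_(u in `[0%R, t]) (eta u ^+ 2))%R in
  let beta : R -> \bar R := frontier phi t0 in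
  let gamma : R -> \bar R := frontier psi t0 in
  let candidate : R -> \bar R :=
    fun s' => mine ((2^-1)%:E * beta (2 * s')%R)%E (gamma s') in
  egraph candidate `&` @microlocal_region R !=set0 ->
  {ae P, forall w,
    egraph (frontier (X ^~ w) t0) `&` @microlocal_region R =
    egraph candidate `&` @microlocal_region R}.
Proof.
move=> phi beta gamma candidate _.
have [hWt hWc] := hW.
have := wiener_frontier hB heta hWt hX ht0 hWc.
(* Points of the region have negative abscissa, where the two functions coincide. *)
apply: filterS => w H; apply/seteqP; split => -[s y] /= [h D]; split => //;
  move: h; rewrite /egraph /= H//; by move: D; rewrite /microlocal_region/= => /andP[/andP[]].
Qed.
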